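(* Let $s\in(0,1]$, $\lambda>0$, and let $\rho\in L^1(\mathbb{R})\cap L^\infty(\mathbb{R})\cap C^\alpha(\mathbb{R})$ be nonnegative, where $\alpha>\max(1-2s,0)$, with $\int_{\mathbb{R}}\rho\,dx=1$ and $\int_{\mathbb{R}}x^2\rho(x)\,dx<\infty$. Let $\rho_\infty$ be the minimum point of $\mathcal{E}$ on $\mathcal{P}_2(\mathbb{R})$. Then $$\mathcal{E}(\rho)-\mathcal{E}(\rho_\infty)\le\frac{1}{2\lambda}\mathcal{I}(\rho).$$
   Context: $\mathcal{P}_2(\mathbb{R})$ is the set of Borel probability measures on $\mathbb{R}$ with finite second moment. Absolutely continuous measures are identified with their densities. $C^\alpha(\mathbb{R})$ is the space of (globally) H\''older continuous functions with exponent $\alpha\in(0,1]$. In dimension one, let $W(x)=c_{1,s}|x|^{2s-1}$ with $c_{1,s}=\frac{s2^{-2s}\Gamma(1/2-s)}{\pi^{1/2}\Gamma(1+s)}$ for $s\in(0,1]$, $s\ne 1/2$ (so $c_{1,s}<0$ for $s>1/2$), and $W(x)=-\frac1\pi\log|x|$ for $s=1/2$. Put $(-\partial_{xx})^{-s}\rho:=W*\rho$. The energy is $\mathcal{E}(\rho)=\frac12\iint_{\mathbb{R}\times\mathbb{R}}W(x-y)\,d\rho(x)d\rho(y)+\frac{\lambda}{2}\int_{\mathbb{R}}x^2\,d\rho(x)$, and the entropy dissipation is $\mathcal{I}(\rho)=\int_{\mathbb{R}}\big|\partial_x(-\partial_{xx})^{-s}\rho(x)+\lambda x\big|^2\rho(x)\,dx$.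 (For $\rho$ as in the claim, $(-\partial_{xx})^{-s}\rho$ is of class $C^1$.) *)

(* Defs.v *)
From HB Require Import structures.
From mathcomp Require Import all_boot all_order all_algebra.
From mathcomp Require Import all_classical all_reals all_analysis.
From mathcomp Require Import measurable_realfun.

Set Implicit Arguments.
Unset Strict Implicit.
Unset Printing Implicit Defensive.

Import Order.TTheory GRing.Theory Num.Theory.
Import numFieldNormedType.Exports.

Local Open Scope classical_set_scope.
Local Open Scope ring_scope.

Section Kernel.
Variable R : realType.
Implicit Types s x : R.

Definition gamma_integral x : R :=
  \int[lebesgue_measure]_(t in `]0, +oo[) (t `^ (x - 1) * expR (- t)).

(* The Gamma function on ]-1, +oo[ minus 0: Euler's integral for x > 0, and the
   functional equation Gamma(x + 1) = x Gamma(x) for -1 < x < 0.  Below it is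
   used at 1/2 - s >= -1/2 and at 1 + s only; values at x <= -1 and at x = 0
   are meaningless. *)
Definition gamma x : R :=
  if 0 < x then gamma_integral x else gamma_integral (x + 1) / x.

Definition riesz_const s : R :=
  s * 2 `^ (- (2 * s)) * gamma (2^-1 - s) / (Num.sqrt pi * gamma (1 + s)).

(* The case s <= 1/2 at x = 0 is treated apart because the library sets
   0 `^ a = 0 for a < 0 and ln 0 = 0, whereas W(0) = +oo. *)
Definition riesz_kernel s x : \bar R :=
  if (x == 0) && (s <= 2^-1) then +oo%E
  else if s == 2^-1 then (- (pi^-1 * ln `|x|))%:E
  else (riesz_const s * `|x| `^ (2 * s - 1))%:E.

(* The real function W * rho. *)
Definition riesz_potential s (rho : R -> R) x : R :=
  fine (\int[lebesgue_measure]_y (riesz_kernel s (x - y) * (rho y)%:E))%E.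

End Kernel.

Section Density.
Variables (R : realType) (rho : R -> R).
Hypothesis rho_L1 : rho \in Lfun (@lebesgue_measure R) 1%E.
Hypothesis rho_ge0 : forall x, 0 <= rho x.
Hypothesis rho_mass : (\int[lebesgue_measure]_x (rho x)%:E = 1)%E.

(* The probability measure with density rho.  The hypotheses are arguments so
   that it carries the instances declared below. *)
Definition density_prob of rho \in Lfun (@lebesgue_measure R) 1%E &
    (forall x, 0 <= rho x) &
    (\int[lebesgue_measure]_x (rho x)%:E = 1)%E :=
  fun A : set (measurableTypeR R) =>
    (\int[lebesgue_measure]_(x in A) (rho x)%:E)%E.

Local Notation mu := (density_prob rho_L1 rho_ge0 rho_mass).

Let density0 : mu set0 = 0%E.
Proof. by rewrite /density_prob integral_set0. Qed.

Let density_ge0 A : (0 <= mu A)%E.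
Proof. by apply: integral_ge0 => x _; rewrite lee_fin. Qed.

Let density_sigma_additive : semi_sigma_additive mu.
Proof.
move=> /= A mA tA mUA; rewrite /density_prob ge0_integral_bigcup//=.
- by apply: is_cvg_ereal_nneg_natsum_cond => n _ _; exact: density_ge0.
- apply/measurable_EFinP/measurable_funTS.
  by have := sub_Lfun_mfun rho_L1; rewrite inE.
- by move=> x _; rewrite lee_fin.
Qed.

HB.instance Definition _ :=
  isMeasure.Build _ _ _ mu density0 density_ge0 density_sigma_additive.

HB.instance Definition _ :=
  @Measure_isProbability.Build _ _ R mu rho_mass.

End Density.

Section Energy.
Variable R : realType.
Implicit Types (s lambda : R) (mu : probability (measurableTypeR R) R).

Definition finite_second_moment mu := (\int[mu]_x (x ^+ 2)%:E < +oo)%E.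

(* Extended-real valued: an atom gives infinite energy when s <= 1/2. *)
Definition energy s lambda mu : \bar R :=
  ((2^-1)%:E * \int[mu \x mu]_z riesz_kernel s (z.1 - z.2)
   + (lambda / 2)%:E * \int[mu]_x (x ^+ 2)%:E)%E.

Definition energy_minimizer s lambda mu :=
  finite_second_moment mu /\
  forall nu : probability (measurableTypeR R) R,
    finite_second_moment nu -> (energy s lambda mu <= energy s lambda nu)%E.

Definition entropy_dissipation s lambda (rho : R -> R) : \bar R :=
  (\int[lebesgue_measure]_x
     (`|(riesz_potential s rho)^`()%classic x + lambda * x| ^+ 2 * rho x)%:E)%E.

Definition hoelder_continuous (alpha : R) (f : R -> R) :=
  exists C : R, forall x y, `|f x - f y| <= C * `|x - y| `^ alpha.

End Energy.

(* Main.v *)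
Require Import Defs.
From HB Require Import structures.
From mathcomp Require Import all_boot all_order all_algebra.
From mathcomp Require Import all_classical all_reals all_analysis.
From mathcomp Require Import measurable_realfun ring lra.

(* Displacement convexity.  For every s the kernel is W(x) = w(|x|) with w convex
   on ]0, +oo[ and w'(x) = - k x ^ (2s - 2), k >= 0.  If T is the monotone map
   from rho to another measure nu, then x - y and T x - T y have the same sign,
   so the tangent inequality of w bounds W(T x - T y) from below.  After
   integration and symmetrization this reads, with D(x) = T x - x and
   xi = (W * rho)' + lambda x,
     E(nu) >= E(rho) + int (D xi + lambda D^2 / 2) rho
           >= E(rho) - (2 lambda)^-1 int xi^2 rho.
   W' is not integrable at 0 for s <= 1/2, so w is first replaced on [0, e] by its
   tangent at e: this keeps convexity, lowers the kernel and makes it Lipschitz.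
   As e tends to 0 the regularized potentials converge uniformly because rho is
   bounded, and their derivatives because rho is Hoelder continuous and the
   truncated force is odd; so W * rho is differentiable and the regularized
   inequality passes to the limit. *)

Set Implicit Arguments.
Unset Strict Implicit.
Unset Printing Implicit Defensive.

Import Order.TTheory GRing.Theory Num.Theory.
Import numFieldNormedType.Exports.

Local Open Scope classical_set_scope.
Local Open Scope ring_scope.

(** * Truncated kernels *)

Section PowerInequalities.
Variable R : realType.
Implicit Types a b q t x : R.

Lemma ln_le_subr1 t : 0 < t -> ln t <= t - 1.
Proof.
move=> t0; rewrite -ler_expR lnK ?posrE//.
by rewrite -[leLHS](subrK 1) addrC expR_ge1Dx.
Qed.

Lemma powR_ge_tangent1 q t : q <= 0 -> 0 < t -> 1 + q * (t - 1) <= t `^ q.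
Proof.
move=> q0 t0; rewrite /powR gt_eqF//; apply: le_trans (expR_ge1Dx _).
by rewrite lerD2l ler_wnM2l// ln_le_subr1.
Qed.

(* Convexity of exp on the segment from 0 to ln t, obtained by averaging its
   two tangent inequalities at the point q * ln t. *)
Lemma powR_le_tangent1 q t : 0 <= q <= 1 -> 0 < t -> t `^ q <= 1 + q * (t - 1).
Proof.
move=> /andP[q0 q1] t0; rewrite /powR gt_eqF//.
set y := ln t; have te : t = expR (q * y) * expR (y - q * y).
  by rewrite -expRD addrC subrK lnK.
have oe : 1 = expR (q * y) * expR (- (q * y)) by rewrite -expRD subrr expR0.
have h1 := expR_ge1Dx (y - q * y).
have h2 := expR_ge1Dx (- (q * y)).
have e0 := expR_gt0 (q * y).
have h3 : expR (q * y) * (1 + (y - q * y)) <= t by rewrite te ler_wpM2l// ltW.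
have h4 : expR (q * y) * (1 - q * y) <= 1 by rewrite [leRHS]oe ler_wpM2l// ltW.
have h5 : q * (expR (q * y) * (1 + (y - q * y))) <= q * t by rewrite ler_wpM2l.
have h6 : (1 - q) * (expR (q * y) * (1 - q * y)) <= (1 - q) * 1.
  by rewrite ler_wpM2l// subr_ge0.
by lra.
Qed.

Lemma powR_tangent_factor q a b : 0 < a ->
  a `^ q + q * a `^ (q - 1) * (b - a) = a `^ q * (1 + q * (b / a - 1)).
Proof.
move=> a0; rewrite powRB ?(gt_eqF a0) ?implybT// powRr1 ?ltW//.
by field; rewrite gt_eqF.
Qed.

Lemma powR_factor q a b : 0 < a -> 0 < b -> b `^ q = a `^ q * (b / a) `^ q.
Proof.
by move=> a0 b0; rewrite -powRM ?divr_ge0 ?ltW// mulrC divfK// gt_eqF.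
Qed.

Lemma powR_ge_tangent q a b : q <= 0 -> 0 < a -> 0 < b ->
  a `^ q + q * a `^ (q - 1) * (b - a) <= b `^ q.
Proof.
move=> q0 a0 b0; rewrite powR_tangent_factor// (powR_factor q a0 b0).
by rewrite ler_wpM2l ?powR_ge0// powR_ge_tangent1// divr_gt0.
Qed.

Lemma powR_le_tangent q a b : 0 <= q <= 1 -> 0 < a -> 0 < b ->
  b `^ q <= a `^ q + q * a `^ (q - 1) * (b - a).
Proof.
move=> q0 a0 b0; rewrite powR_tangent_factor// (powR_factor q a0 b0).
by rewrite ler_wpM2l ?powR_ge0// powR_le_tangent1// divr_gt0.
Qed.

End PowerInequalities.

Section TruncatedKernel.
Variable R : realType.
Variables (w : R -> R) (k p : R).
Hypotheses (k_ge0 : 0 <= k) (p_ge0 : 0 <= p).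
Hypothesis w_tangent : forall a b : R, 0 < a -> 0 < b ->
  w a - k * a `^ (- p) * (b - a) <= w b.
Implicit Types a b e u h x z : R.

Definition trunc_slope e x : R := - (k * Num.max x e `^ (- p)).

(* Below e, w is replaced by its tangent at e. *)
Definition trunc_profile e x : R :=
  w (Num.max x e) - trunc_slope e e * Num.max (e - x) 0.

Definition trunc_kernel e z : R := trunc_profile e `|z|.

Definition trunc_force e z : R := Num.sg z * trunc_slope e `|z|.

Section FixedTruncation.
Variable e : R.
Hypothesis e_gt0 : 0 < e.

Let max_gt0 x : 0 < Num.max x e.
Proof. by rewrite lt_max e_gt0 orbT. Qed.

Definition trunc_lip : R := k * e `^ (- p).

Lemma trunc_lip_ge0 : 0 <= trunc_lip.
Proof. by rewrite mulr_ge0// powR_ge0. Qed.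

Lemma trunc_slopeE x : e <= x -> trunc_slope e x = - (k * x `^ (- p)).
Proof. by move=> ex; rewrite /trunc_slope max_l. Qed.

Lemma trunc_slopeE' x : x <= e -> trunc_slope e x = - trunc_lip.
Proof. by move=> ex; rewrite /trunc_slope max_r. Qed.

Lemma trunc_profileE x : e <= x -> trunc_profile e x = w x.
Proof.
by move=> ex; rewrite /trunc_profile max_l// max_r ?subr_le0// mulr0 subr0.
Qed.

Lemma trunc_profileE' x : x <= e ->
  trunc_profile e x = w e + trunc_lip * (e - x).
Proof.
move=> ex; rewrite /trunc_profile max_r// max_l ?subr_ge0//.
by rewrite trunc_slopeE' ?lexx// mulNr opprK.
Qed.

Lemma powRN_le a b : 0 < a -> a <= b -> b `^ (- p) <= a `^ (- p).
Proof.
move=> a0 ab; have b0 := lt_le_trans a0 ab.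
rewrite !powRN lef_pV2 ?posrE ?powR_gt0//.
by apply: ge0_ler_powR => //; rewrite nnegrE ltW.
Qed.

Lemma trunc_slope_le0 x : trunc_slope e x <= 0.
Proof. by rewrite oppr_le0 mulr_ge0// powR_ge0. Qed.

Lemma trunc_slope_ge x : - trunc_lip <= trunc_slope e x.
Proof. by rewrite lerN2 ler_wpM2l// powRN_le// le_max lexx orbT. Qed.

Lemma trunc_slope_nd : {homo trunc_slope e : a b / a <= b}.
Proof.
move=> a b ab; rewrite lerN2 ler_wpM2l// powRN_le//.
by rewrite ge_max !le_max ab lexx orbT.
Qed.

Definition trunc_slope_lip : R := k * (p * e `^ (- p - 1)).

Lemma trunc_slope_lip_ge0 : 0 <= trunc_slope_lip.
Proof. by rewrite !mulr_ge0// powR_ge0. Qed.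

Lemma trunc_slope_lipschitz a b :
  `|trunc_slope e a - trunc_slope e b| <= trunc_slope_lip * `|a - b|.
Proof.
wlog ab : a b / a <= b => [hw|].
  by have [/hw//|/ltW/hw] := leP a b; rewrite distrC (distrC a).
rewrite distrC (distrC a) ger0_norm ?subr_ge0 ?trunc_slope_nd//.
rewrite (@ger0_norm _ (b - a)) ?subr_ge0//.
rewrite /trunc_slope opprK addrC -mulrBr -mulrA ler_wpM2l//.
set A := Num.max a e; set B := Num.max b e.
have AB : A <= B by rewrite ge_max !le_max ab lexx orbT.
have BA : B - A <= b - a.
  by rewrite /A /B; have [?|?] := leP a e; have [?|?] := leP b e; lra.
have p0 : - p <= 0 by rewrite oppr_le0.
have := powR_ge_tangent p0 (max_gt0 a) (max_gt0 b); rewrite -/A -/B => H.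
have : A `^ (- p) - B `^ (- p) <= p * A `^ (- p - 1) * (B - A) by lra.
move=> /le_trans; apply.
apply: ler_pM; rewrite ?subr_ge0// ?mulr_ge0 ?powR_ge0//.
rewrite ler_wpM2l//; rewrite -opprD !powRN lef_pV2 ?posrE ?powR_gt0 ?max_gt0//.
have eA : e <= A by rewrite /A le_max lexx orbT.
apply: ge0_ler_powR; rewrite ?nnegrE//; first exact: addr_ge0.
- exact: ltW.
- exact/ltW/max_gt0.
Qed.

Lemma trunc_profile_tangent a b :
  trunc_profile e a + trunc_slope e a * (b - a) <= trunc_profile e b.
Proof.
have [ae|ea] := leP a e; have [be|eb] := leP b e.
- by rewrite !trunc_profileE'// trunc_slopeE'//; lra.
- rewrite trunc_profileE'// (trunc_profileE (ltW eb)) trunc_slopeE'//.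
  have := w_tangent e_gt0 (lt_trans e_gt0 eb); rewrite -/trunc_lip => H; lra.
- rewrite trunc_profileE ?(ltW ea)// (trunc_profileE' be).
  have a0 := lt_trans e_gt0 ea.
  have := w_tangent a0 e_gt0; rewrite -mulNr -(trunc_slopeE (ltW ea)) => H.
  have H2 : 0 <= (trunc_lip + trunc_slope e a) * (e - b).
    have ? := trunc_slope_ge a.
    by apply: mulr_ge0; lra.
  by lra.
- rewrite (trunc_profileE (ltW ea)) (trunc_profileE (ltW eb)).
  rewrite (trunc_slopeE (ltW ea)) mulNr.
  by apply: w_tangent; apply: lt_trans e_gt0 _.
Qed.

Lemma trunc_profile_lipschitz a b :
  `|trunc_profile e a - trunc_profile e b| <= trunc_lip * `|a - b|.
Proof.
wlog ab : a b / a <= b => [hw|].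
  by have [/hw//|/ltW/hw] := leP a b; rewrite distrC (distrC a).
have := trunc_profile_tangent a b; have := trunc_profile_tangent b a.
have := trunc_slope_ge a; have := trunc_slope_le0 b.
move=> H1 H2 H3 H4; have h0 : 0 <= b - a by rewrite subr_ge0.
rewrite (distrC a) (@ger0_norm _ (b - a))//.
have H5 : trunc_slope e b * (b - a) <= 0 by rewrite mulr_le0_ge0.
have H6 : - trunc_lip * (b - a) <= trunc_slope e a * (b - a).
  by rewrite ler_wpM2r.
by rewrite ler_norml; apply/andP; split; lra.
Qed.

Lemma trunc_profile_le x : 0 < x -> trunc_profile e x <= w x.
Proof.
move=> x0; have [xe|/ltW ex] := leP x e; last by rewrite trunc_profileE.
rewrite trunc_profileE'//.
by have := w_tangent e_gt0 x0; rewrite -/trunc_lip => H; lra.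
Qed.

Lemma trunc_kernelN z : trunc_kernel e (- z) = trunc_kernel e z.
Proof. by rewrite /trunc_kernel normrN. Qed.

Lemma trunc_forceN z : trunc_force e (- z) = - trunc_force e z.
Proof. by rewrite /trunc_force normrN sgrN mulNr. Qed.

Lemma trunc_kernel_lipschitz u z :
  `|trunc_kernel e u - trunc_kernel e z| <= trunc_lip * `|u - z|.
Proof.
apply: (le_trans (trunc_profile_lipschitz _ _)).
by rewrite ler_wpM2l ?trunc_lip_ge0// ler_dist_dist.
Qed.

Lemma trunc_force_bound z : `|trunc_force e z| <= trunc_lip.
Proof.
rewrite /trunc_force normrM normr_sg; have [->|z0] := eqVneq z 0.
  by rewrite mul0r trunc_lip_ge0.
rewrite mul1r ler0_norm ?trunc_slope_le0//.
by have := trunc_slope_ge `|z| => ?; lra.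
Qed.

(* Both arguments on the same side of 0: there the kernel is convex. *)
Lemma trunc_kernel_tangent u z : (u = 0 -> z = 0) -> 0 <= u * z ->
  trunc_kernel e u + trunc_force e u * (z - u) <= trunc_kernel e z.
Proof.
wlog u0 : u z / 0 <= u => [hw|].
  move=> uz0 uz; have [u0|u0] := leP 0 u; first exact: hw.
  have := hw (- u) (- z); rewrite !trunc_kernelN trunc_forceN.
  rewrite oppr_ge0 (ltW u0) mulrNN -opprD mulrNN; apply => //.
  by move/eqP; rewrite oppr_eq0 => /eqP/uz0 ->; rewrite oppr0.
move=> uz0 uz; have [u_eq0|un0] := eqVneq u 0.
  by rewrite (uz0 u_eq0) u_eq0 subrr mulr0 addr0.
have up : 0 < u by rewrite lt0r un0.
have z0 : 0 <= z by move: uz; rewrite pmulr_rge0.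
rewrite /trunc_kernel /trunc_force !ger0_norm// gtr0_sg// mul1r.
exact: trunc_profile_tangent.
Qed.

Lemma trunc_kernel_taylor u h :
  `|trunc_kernel e (u + h) - trunc_kernel e u - h * trunc_force e u|
  <= trunc_slope_lip * h ^+ 2
     + (2 * trunc_lip * `|h|) * (`|u| <= `|h|)%R%:R.
Proof.
wlog u0 : u h / 0 <= u => [hw|].
  have [u0|u0] := leP 0 u; first exact: hw.
  have := hw (- u) (- h); rewrite -opprD !trunc_kernelN trunc_forceN.
  by rewrite mulrNN sqrrN !normrN; apply; rewrite oppr_ge0 ltW.
have [uh|hu] := leP `|u| `|h|.
  rewrite mulr1; apply: (@le_trans _ _ (2 * trunc_lip * `|h|)); last first.
    by rewrite lerDr mulr_ge0 ?trunc_slope_lip_ge0// sqr_ge0.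
  apply: (le_trans (ler_normB _ _)).
  have := trunc_kernel_lipschitz (u + h) u.
  have -> : u + h - u = h by ring.
  move=> H1.
  have H2 : `|h * trunc_force e u| <= trunc_lip * `|h|.
    by rewrite normrM mulrC ler_wpM2r// trunc_force_bound.
  by lra.
rewrite mulr0 addr0.
rewrite (ger0_norm u0) in hu.
have up : 0 < u by exact: le_lt_trans hu.
have uh : 0 < u + h by move: hu; rewrite ltr_norml => /andP[] *; lra.
rewrite /trunc_kernel /trunc_force (gtr0_norm uh) (gtr0_norm up) gtr0_sg// mul1r.
have := trunc_profile_tangent u (u + h).
have := trunc_profile_tangent (u + h) u.
have := trunc_slope_lipschitz (u + h) u.
have -> : u - (u + h) = - h by ring.
have -> : u + h - u = h by ring.
move=> H1 H2 H3.
have H4 : `|h * (trunc_slope e (u + h) - trunc_slope e u)|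
    <= trunc_slope_lip * h ^+ 2.
  rewrite normrM -(real_normK (num_real h)) expr2 mulrCA.
  by rewrite ler_wpM2l.
rewrite ger0_norm; last by lra.
apply: le_trans H4; apply: le_trans (ler_norm _); lra.
Qed.

End FixedTruncation.

Lemma trunc_force_diff e d z : 0 < d -> d <= e ->
  `|trunc_force d z - trunc_force e z|
  <= (0 < `|z| < e)%R%:R * (k * `|z| `^ (- p)).
Proof.
move=> d0 de; have e0 := lt_le_trans d0 de.
rewrite /trunc_force -mulrBr normrM normr_sg normr_gt0.
have [->|z0] /= := eqVneq z 0; first by rewrite !mul0r.
have zp : 0 < `|z| by rewrite normr_gt0.
rewrite mul1r; have [ez|ze] := leP e `|z|.
  by rewrite !trunc_slopeE// ?(le_trans de)// subrr normr0 mul0r.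
rewrite mul1r.
have h1 : trunc_slope d `|z| <= trunc_slope e `|z|.
  rewrite /trunc_slope lerN2 ler_wpM2l// powRN_le//.
    by rewrite lt_max zp.
  by rewrite ge_max !le_max lexx de orbT.
have h2 : - (k * `|z| `^ (- p)) <= trunc_slope d `|z|.
  by rewrite /trunc_slope lerN2 ler_wpM2l// powRN_le// le_max lexx.
have h3 := trunc_slope_le0 e `|z|.
by rewrite distrC ger0_norm; lra.
Qed.

End TruncatedKernel.

(** * Lebesgue integrals *)

Section LebesgueReflection.
Variable R : realType.
Local Open Scope ereal_scope.
Local Notation leb := (@lebesgue_measure R).

Let reflect (c : R) : measurableTypeR R -> measurableTypeR R := fun y => (c - y)%R.

Let measurable_reflect (c : R) : measurable_fun [set: measurableTypeR R] (reflect c).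
Proof. exact: measurable_funB. Qed.

HB.instance Definition _ (c : R) :=
  isMeasurableFun.Build _ _ _ _ (reflect c) (measurable_reflect c).

Let lebesgue_measure_reflect (c : R) (A : set R) : measurable A ->
  pushforward leb (reflect c) A = leb A.
Proof.
move=> mA; apply/esym/lebesgue_measure_unique => //= _ [[a b]] _ <-.
rewrite /pushforward/=.
have -> : reflect c @^-1` `]a, b] = `[(c - b)%R, (c - a)%R[%classic.
  by apply/seteqP; split => y/=; rewrite /reflect !in_itv/= => /andP[? ?];
    apply/andP; split; lra.
rewrite !lebesgue_measure_itv/= !lte_fin ltrD2l ltrN2.
by case: ifP => // _; rewrite -!EFinB; congr EFin; ring.
Qed.

Lemma ge0_integral_reflect (c : R) (f : R -> \bar R) :
  measurable_fun [set: R] f -> (forall y, 0 <= f y) ->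
  \int[leb]_y f (c - y)%R = \int[leb]_y f y.
Proof.
move=> mf f0.
transitivity (\int[pushforward leb (reflect c)]_y f y).
  by rewrite (ge0_integral_pushforward (measurable_reflect c))//.
by apply: eq_measure_integral => A mA _; exact: lebesgue_measure_reflect.
Qed.

Lemma integral_reflect (c : R) (f : R -> \bar R) : measurable_fun [set: R] f ->
  \int[leb]_y f (c - y)%R = \int[leb]_y f y.
Proof.
move=> mf; rewrite integralE [RHS]integralE; congr (_ - _).
  rewrite -[RHS](@ge0_integral_reflect c (f^\+))//; last exact: measurable_funepos.
  by apply: eq_integral => y _; rewrite !funeposE.
rewrite -[RHS](@ge0_integral_reflect c (f^\-))//; last exact: measurable_funeneg.
by apply: eq_integral => y _; rewrite !funenegE.
Qed.

Lemma integral_odd_eq0 (f : R -> \bar R) : measurable_fun [set: R] f ->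
  (forall y, f (- y)%R = - f y) -> leb.-integrable [set: R] f ->
  \int[leb]_y f y = 0.
Proof.
move=> mf fN intf; have := integral_reflect 0 mf.
under eq_integral do rewrite sub0r fN.
rewrite integralN; last exact: integrable_add_def.
have := integrable_fin_num measurableT intf.
by case: (\int[leb]_y f y) => [r| |]// _ [] ?; congr EFin; lra.
Qed.

End LebesgueReflection.

Section PowerIntegral.
Variables (R : realType) (a : R).
Hypothesis a_gt : -1 < a.
Local Notation leb := (@lebesgue_measure R).

Let a1_gt0 : 0 < 1 + a. Proof. by move: a_gt; lra. Qed.

Let integral_powR_cc (d e : R) : 0 < d -> d < e ->
  (\int[leb]_(x in `[d, e]) (x `^ a)%:E <= (e `^ (1 + a) / (1 + a))%:E)%E.
Proof.
move=> d0 de.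
have dF (x : R) : 0 < x ->
    is_derive x 1 (fun x => x `^ (1 + a) / (1 + a)) (x `^ a).
  move=> x0; have H := @is_derive1_powR R (1 + a) x x0.
  apply: is_derive_eq.
  rewrite /= scaler0 add0r /GRing.scale/=.
  have -> : 1 + a - 1 = a by ring.
  by field; rewrite gt_eqF.
rewrite (@continuous_FTC2 _ _ (fun x => x `^ (1 + a) / (1 + a)))//.
- by rewrite -EFinB lee_fin gerBl divr_ge0 ?powR_ge0// ltW.
- apply: derivable_within_continuous => x; rewrite in_itv/= => /andP[dx _].
  by apply: derivable_powR; rewrite in_itv/= andbT (lt_le_trans d0).
- have cF (x : R) : 0 < x -> {for x, continuous (fun x => x `^ (1 + a) / (1 + a))}.
    by move=> x0; apply/differentiable_continuous/derivable1_diffP; have [] := dF x x0.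
  split.
  + by move=> x; rewrite in_itv/= => /andP[dx _]; have [] := dF x (lt_trans d0 dx).
  + by apply: cvg_at_right_filter; apply: cF.
  + by apply: cvg_at_left_filter; apply: cF; apply: lt_trans de.
- move=> x; rewrite in_itv/= => /andP[dx _]; rewrite derive1E.
  by have [_ ->] := dF x (lt_trans d0 dx).
Qed.

Let measurable_powR_fun (D : set R) : measurable_fun D (fun x : R => (x `^ a)%:E).
Proof. by apply/measurable_funTS/measurable_EFinP; exact: measurable_powR. Qed.

Let integral_powR_oc (e : R) : 0 < e ->
  (\int[leb]_(x in `]0%R, e]) (x `^ a)%:E <= (e `^ (1 + a) / (1 + a))%:E)%E.
Proof.
move=> e0.
pose F n := `[(e / n.+2%:R)%R, e]%classic.
have -> : `]0%R, e]%classic = \bigcup_n F n.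
  apply/seteqP; split => [x/=|x/= [n _]/=]; rewrite /F/= !in_itv/=.
    move=> /andP[x0 xe]; have := archi_boundP (ltW (divr_gt0 e0 x0)).
    set n := Num.bound _ => nx; exists n => //=; rewrite in_itv/= xe andbT.
    rewrite ler_pdivrMr// mulrC -ler_pdivrMr//; apply: (le_trans (ltW nx)).
    by rewrite ler_nat -addn2 leq_addr.
  by move=> /andP[nx ->]; rewrite andbT (lt_le_trans _ nx)// divr_gt0.
have nF : nondecreasing_seq F.
  move=> m n mn; rewrite subsetEset /F => x/=; rewrite !in_itv/= => /andP[mx ->].
  rewrite andbT (le_trans _ mx)// ler_pM2l// lef_pV2 ?posrE//.
  by rewrite ler_nat.
have mF n : measurable (F n) by exact: measurable_itv.
have powR_pos n (x : R) : F n x -> (0 <= (x `^ a)%:E)%E by rewrite lee_fin powR_ge0.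
have := @ge0_nondecreasing_set_cvg_integral _ (measurableTypeR R) R F
  (fun x : R => (x `^ a)%:E) lebesgue_measure nF mF
  (fun n => @measurable_powR_fun _) powR_pos.
apply: cvge_le; apply: nearW => n; apply: integral_powR_cc.
  by rewrite divr_gt0.
by rewrite ltr_pdivrMr// ltr_pMr// ltr1n.
Qed.

Definition punctured_powR (e y : R) : R := (0 < `|y| < e)%R%:R * `|y| `^ a.

Lemma punctured_powR_ge0 e y : 0 <= punctured_powR e y.
Proof. by rewrite mulr_ge0// powR_ge0. Qed.

Lemma measurable_punctured_powR e : measurable_fun [set: R] (punctured_powR e).
Proof.
apply: measurable_funM; last first.
  by apply: (measurableT_comp (measurable_powR a)); exact: normr_measurable.
have -> : (fun y : R => ((0 < `|y| < e)%R%:R : R)) =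
    \1_(`]0, e[%classic) \o Num.norm.
  by apply/funext => y/=; rewrite indicE mem_setE in_itv.
apply: measurableT_comp; last exact: normr_measurable.
exact: measurable_indic.
Qed.

Lemma integral_punctured_powR (c e : R) : 0 < e ->
  (\int[leb]_y (punctured_powR e (c - y))%:E <= (2 * (e `^ (1 + a) / (1 + a)))%:E)%E.
Proof.
move=> e0; rewrite (@ge0_integral_reflect R c (fun y => (punctured_powR e y)%:E)); first last.
- by move=> y; rewrite lee_fin punctured_powR_ge0.
- apply/measurable_EFinP; exact: measurable_punctured_powR.
pose h (y : R) : \bar R := (y `^ a * \1_(`]0%R, e]%classic) y)%:E.
have mh : measurable_fun [set: R] h.
  apply/measurable_EFinP/measurable_funM; first exact: measurable_powR.
  exact: measurable_indic.
have h0 y : (0 <= h y)%E by rewrite lee_fin mulr_ge0// powR_ge0.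
have hint : (\int[leb]_y h y <= (e `^ (1 + a) / (1 + a))%:E)%E.
  apply: le_trans (integral_powR_oc e0).
  rewrite [leRHS]integral_mkcond le_eqVlt; apply/orP; left; apply/eqP.
  apply: eq_integral => y _; rewrite patchE /h indicE.
  by case: ifP; rewrite ?mulr1 ?mulr0.
apply: (@le_trans _ _ (\int[leb]_y (h y + h (0 - y)%R)%E)%E).
  apply: ge0_le_integral => //.
  - by move=> y _; rewrite lee_fin punctured_powR_ge0.
  - by apply/measurable_EFinP; exact: measurable_punctured_powR.
  - apply: emeasurable_funD => //; apply: (measurableT_comp mh).
    exact: measurable_funB.
  - move=> y _; rewrite /h -EFinD lee_fin /punctured_powR sub0r !indicE !mem_setE !in_itv/=.
    have [y0|y0|<-] := ltgtP 0 y.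
    + rewrite gtr0_norm// y0/= oppr_gt0 (lt_gtF y0)/= mulr0 addr0 mulrC.
      by rewrite ler_wpM2l ?powR_ge0// ler_nat; case: ltP => // /ltW ->.
    + rewrite ltr0_norm// oppr_gt0 y0/= mulr0 add0r mulrC.
      by rewrite ler_wpM2l ?powR_ge0// ler_nat; case: ltP => // /ltW ->.
    + by rewrite normr0 ltxx/= mul0r oppr0 ltxx/= !mulr0 addr0.
rewrite ge0_integralD//; last first.
  by apply: (measurableT_comp mh); exact: measurable_funB.
rewrite ge0_integral_reflect// mulr_natl mulr2n EFinD.
by apply: leeD.
Qed.

End PowerIntegral.

#[local] Instance ae_lebesgue_filter (R : realType) :
  Filter (almost_everywhere (@lebesgue_measure R)).
Proof. exact: ae_filter_ringOfSetsType. Qed.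

Section Density.
Variables (R : realType) (m : probability (measurableTypeR R) R) (rho : R -> R).
Local Notation leb := (@lebesgue_measure R).
Hypothesis rho_ge0 : forall x, 0 <= rho x.
Hypothesis mrho : measurable_fun [set: R] rho.
Hypothesis m_density : forall A : set (measurableTypeR R), measurable A ->
  (m A = \int[leb]_(x in A) (rho x)%:E)%E.

Let mErho (D : set R) : measurable_fun D (fun x => (rho x)%:E).
Proof. by apply/measurable_EFinP; exact: measurable_funTS. Qed.

Lemma density_dominated : m `<< leb.
Proof.
apply/null_content_dominatesP => A mA A0; rewrite m_density//.
apply: null_set_integral => //; exact: mErho.
Qed.

Lemma ge0_integral_density (f : R -> \bar R) : measurable_fun [set: R] f ->
  (forall x, 0 <= f x)%E ->
  (\int[m]_x f x = \int[leb]_x (f x * (rho x)%:E))%E.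
Proof.
move=> mf f0; have dom := density_dominated.
have := Radon_Nikodym_SigmaFinite.change_of_variables dom f0 (@measurableT _ R) mf.
move=> <-; apply: ae_eq_integral => //.
- apply: emeasurable_funM => //.
  exact: measurable_int (Radon_Nikodym_SigmaFinite.f_integrable dom).
- apply: emeasurable_funM => //; exact: mErho.
- apply: ae_eqe_mul2l; apply: integral_ae_eq => //.
  + exact: Radon_Nikodym_SigmaFinite.f_integrable.
  + exact: mErho.
  + by move=> E _ mE; rewrite -Radon_Nikodym_SigmaFinite.f_integral//; exact: m_density.
Qed.

Lemma integral_density (f : R -> \bar R) : measurable_fun [set: R] f ->
  (\int[m]_x f x = \int[leb]_x (f x * (rho x)%:E))%E.
Proof.
move=> mf; rewrite integralE [RHS]integralE.
rewrite !ge0_integral_density//; first last.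
- exact: measurable_funepos.
- exact: measurable_funeneg.
congr (_ - _)%E; apply: eq_integral => x _.
- by rewrite !funeposE maxe_pMl ?lee_fin// mul0e.
- by rewrite !funenegE -mulNe maxe_pMl ?lee_fin// mul0e.
Qed.

Variable M : R.
Hypothesis rho_le : \forall x \ae leb, rho x <= M.

Lemma density_bound_ge0 : 0 <= M.
Proof.
rewrite leNgt; apply/negP => M0.
have rho_eq0 : \forall x \ae leb, rho x = 0.
  by apply: filterS rho_le => x xM; have := rho_ge0 x => ?; lra.
have := m_density measurableT; rewrite probability_setT.
rewrite (@ae_eq_integral _ _ _ _ setT (cst 0%E))//; first last.
- by apply: filterS rho_eq0 => x -> .
- exact: mErho.
by rewrite integral0_eq// => /eqP; rewrite eqe oner_eq0.
Qed.

Lemma integral_density_le (f : R -> \bar R) : measurable_fun [set: R] f ->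
  (forall x, 0 <= f x)%E -> (\int[m]_x f x <= M%:E * \int[leb]_x f x)%E.
Proof.
move=> mf f0; rewrite ge0_integral_density// -ge0_integralZl//; last first.
  by rewrite lee_fin density_bound_ge0.
apply: ae_ge0_le_integral => //.
- by move=> x _; rewrite mule_ge0// lee_fin.
- apply: emeasurable_funM => //; exact: mErho.
- by move=> x _; rewrite mule_ge0// lee_fin density_bound_ge0.
- exact: measurable_funeM.
- by apply: filterS rho_le => x xM _; rewrite muleC lee_wpmul2r// lee_fin.
Qed.

End Density.

Section RealIntegrable.
Context d (T : measurableType d) (R : realType) (P : probability T R).
Implicit Types f g : T -> R.

Lemma Rintegrable_measurable f : P.-integrable [set: T] (EFin \o f) ->
  measurable_fun [set: T] f.
Proof. by move=> fi; apply/measurable_EFinP; exact: measurable_int fi. Qed.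

Lemma RintegrableD f g : P.-integrable [set: T] (EFin \o f) ->
  P.-integrable [set: T] (EFin \o g) ->
  P.-integrable [set: T] (EFin \o (fun x => f x + g x)).
Proof. by move=> fi gi; exact: (integrableD measurableT fi gi). Qed.

Lemma RintegrableB f g : P.-integrable [set: T] (EFin \o f) ->
  P.-integrable [set: T] (EFin \o g) ->
  P.-integrable [set: T] (EFin \o (fun x => f x - g x)).
Proof. by move=> fi gi; exact: (integrableB measurableT fi gi). Qed.

Lemma RintegrableZ (c : R) f : P.-integrable [set: T] (EFin \o f) ->
  P.-integrable [set: T] (EFin \o (fun x => c * f x)).
Proof. by move=> fi; exact: (integrableZl measurableT c fi). Qed.

Lemma Rintegrable_cst (c : R) : P.-integrable [set: T] (EFin \o (fun=> c)).
Proof. exact: finite_measure_integrable_cst. Qed.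

Lemma Rintegral_probability_cst (c : R) : \int[P]_x c = c.
Proof.
have := Rintegral_cst P (@measurableT _ T) c => ->.
by rewrite [X in fine X](probability_setT P) mulr1.
Qed.

Lemma le_Rintegrable f g : measurable_fun [set: T] f ->
  (forall x, `|f x| <= g x) -> P.-integrable [set: T] (EFin \o g) ->
  P.-integrable [set: T] (EFin \o f).
Proof.
move=> mf fg; apply: le_integrable => //; first exact/measurable_EFinP.
by move=> x _ /=; rewrite lee_fin (le_trans (fg x))// ler_norm.
Qed.

Lemma RintegrableM (L : R) f g : measurable_fun [set: T] f ->
  (forall x, `|f x| <= L) -> P.-integrable [set: T] (EFin \o g) ->
  P.-integrable [set: T] (EFin \o (fun x => f x * g x)).
Proof.
move=> mf fL gi.
apply: (@le_Rintegrable _ (fun x => L * `|g x|)).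
- by apply: measurable_funM => //; exact: Rintegrable_measurable.
- by move=> x; rewrite normrM ler_wpM2r.
- by apply: RintegrableZ; exact: integrable_norm gi.
Qed.

Lemma square_integrable f : measurable_fun [set: T] f ->
  P.-integrable [set: T] (EFin \o (fun x => f x ^+ 2)) ->
  P.-integrable [set: T] (EFin \o f).
Proof.
move=> mf f2; apply: (@le_Rintegrable _ (fun x => 1 + f x ^+ 2)) => //.
  by move=> x; rewrite ler_norml; apply/andP; split; nra.
by apply: RintegrableD f2; exact: Rintegrable_cst.
Qed.

End RealIntegrable.

Section Moments.
Variables (R : realType) (m : probability (measurableTypeR R) R).
Hypothesis m_moment2 : m.-integrable [set: R] (EFin \o (fun x => x ^+ 2)).

Lemma integrable_id : m.-integrable [set: R] (EFin \o @id R).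
Proof. by apply: square_integrable m_moment2; exact: measurable_id. Qed.

Lemma integrable_affine_sqr (L c : R) (g : R -> R) : measurable_fun [set: R] g ->
  (forall x, `|g x| <= L) ->
  m.-integrable [set: R] (EFin \o (fun x => (g x + c * x) ^+ 2)).
Proof.
move=> mg gL.
have mgc : measurable_fun [set: R] (fun x => g x + c * x).
  by apply: measurable_funD mg _; exact: measurable_funM.
apply: (@le_Rintegrable _ (measurableTypeR R) R m _
    (fun x : R => 2 * L ^+ 2 + (2 * c ^+ 2) * x ^+ 2)).
- exact: measurable_funX mgc.
- move=> x; rewrite ger0_norm ?sqr_ge0//.
  have gL2 : g x ^+ 2 <= L ^+ 2.
    by rewrite -(real_normK (num_real (g x))) lerXn2r ?nnegrE// (le_trans _ (gL x)).
  have h : 0 <= (g x - c * x) ^+ 2 by exact: sqr_ge0.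
  by move: (g x) gL2 h => y ? ?; lra.
- by apply: RintegrableD; [exact: Rintegrable_cst|exact: RintegrableZ].
Qed.

End Moments.


Section LipschitzIntegrands.
Variable R : realType.

Lemma lipschitz_continuous (L : R) (f : R -> R) :
  (forall x y, `|f x - f y| <= L * `|x - y|) -> continuous f.
Proof.
move=> fL x; apply/cvgrPdist_le => e e0.
have L1 : 0 < `|L| + 1 by rewrite ltr_wpDl.
near=> y.
have xy : `|x - y| <= e / (`|L| + 1).
  by near: y; apply: cvgr_dist_le => //; rewrite divr_gt0.
apply: (le_trans (fL x y)).
apply: (@le_trans _ _ ((`|L| + 1) * `|x - y|)).
  by rewrite ler_wpM2r//; apply: (le_trans (ler_norm L)); rewrite lerDl.
by rewrite mulrC -ler_pdivlMr.
Unshelve. all: by end_near. Qed.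

Lemma lipschitz_measurable (L : R) (f : R -> R) :
  (forall x y, `|f x - f y| <= L * `|x - y|) -> measurable_fun [set: R] f.
Proof.
by move=> fL; apply: continuous_measurable_fun; exact: lipschitz_continuous fL.
Qed.

Lemma bounded_integrable d (T : measurableType d)
    (P : probability T R) (L : R) (f : T -> R) :
  measurable_fun [set: T] f -> (forall x, `|f x| <= L) ->
  P.-integrable [set: T] (EFin \o f).
Proof.
by move=> mf fL; exact: le_Rintegrable fL (Rintegrable_cst P L).
Qed.

Lemma lipschitz_integrable d (T : measurableType d)
    (P : probability T R) (L : R) (f : R -> R) (Z : T -> R) :
  (forall x y, `|f x - f y| <= L * `|x - y|) ->
  P.-integrable [set: T] (EFin \o Z) -> P.-integrable [set: T] (EFin \o (f \o Z)).
Proof.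
move=> fL iZ; have mZ := Rintegrable_measurable iZ.
apply: (@le_Rintegrable _ _ _ _ _ (fun t => `|f 0| + L * `|Z t|)).
- exact: (measurableT_comp (lipschitz_measurable fL) mZ).
- move=> t /=; have := fL (Z t) 0; rewrite subr0 => H.
  by rewrite -lerBlDl; apply: le_trans H; exact: lerB_dist.
- apply: RintegrableD; first exact: Rintegrable_cst.
  by apply: RintegrableZ; exact: integrable_norm iZ.
Qed.

End LipschitzIntegrands.

Section TruncatedMeasurability.
Variables (R : realType) (w : R -> R) (k p : R).
Hypotheses (k_ge0 : 0 <= k) (p_ge0 : 0 <= p).
Hypothesis w_tangent : forall a b : R, 0 < a -> 0 < b ->
  w a - k * a `^ (- p) * (b - a) <= w b.

Lemma measurable_trunc_kernel e : 0 < e ->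
  measurable_fun [set: R] (trunc_kernel w k p e).
Proof.
by move=> e0; apply: lipschitz_measurable => x y; exact: trunc_kernel_lipschitz.
Qed.

Lemma measurable_trunc_force e : 0 < e ->
  measurable_fun [set: R] (trunc_force k p e).
Proof.
move=> e0; apply: measurable_funM.
  apply: nondecreasing_measurable => // x y xy.
  have [x0|x0|x0] := sgrP x; have [y0|y0|y0] := sgrP y; rewrite ?lexx ?ler01//; lra.
apply: (@measurableT_comp _ _ _ _ _ _ (trunc_slope k p e)) => //.
by apply: lipschitz_measurable => x y; exact: trunc_slope_lipschitz.
Qed.

End TruncatedMeasurability.

(** * The regularized potential and its limit *)

Section Potential.
Variables (R : realType) (w : R -> R) (k p : R).
Hypotheses (k_ge0 : 0 <= k) (p_ge0 : 0 <= p).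
Hypothesis w_tangent : forall a b : R, 0 < a -> 0 < b ->
  w a - k * a `^ (- p) * (b - a) <= w b.
Variables (m : probability (measurableTypeR R) R).
Local Notation leb := (@lebesgue_measure R).
Hypothesis m_moment : m.-integrable [set: R] (EFin \o @id R).

Definition trunc_potential e x : R := \int[m]_y trunc_kernel w k p e (x - y).

Definition trunc_field e x : R := \int[m]_y trunc_force k p e (x - y).

Let integrable_sub (x : R) : m.-integrable [set: R] (EFin \o (fun y => x - y)).
Proof.
rewrite (_ : _ \o _ = ((EFin \o cst x) \- (EFin \o @id R))%E)//.
by apply: integrableB => //; exact: finite_measure_integrable_cst.
Qed.

Let measurable_sub (x : R) : measurable_fun [set: R] (fun y : R => x - y).
Proof. exact: measurable_funB. Qed.

Lemma integrable_trunc_kernel e x : 0 < e ->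
  m.-integrable [set: R] (EFin \o (fun y => trunc_kernel w k p e (x - y))).
Proof.
move=> e0.
have := @lipschitz_integrable R _ _ m (trunc_lip k p e) (trunc_kernel w k p e).
by apply=> // u v; exact: trunc_kernel_lipschitz.
Qed.

Lemma integrable_trunc_force e x : 0 < e ->
  m.-integrable [set: R] (EFin \o (fun y => trunc_force k p e (x - y))).
Proof.
move=> e0; apply: (@bounded_integrable R _ _ m (trunc_lip k p e)).
  exact: (measurableT_comp (measurable_trunc_force k_ge0 p_ge0 e0) (measurable_sub x)).
by move=> y; exact: trunc_force_bound.
Qed.

Lemma trunc_field_bound e x : 0 < e -> `|trunc_field e x| <= trunc_lip k p e.
Proof.
move=> e0; have fi := integrable_trunc_force x e0.
apply: (le_trans (le_normr_Rintegral measurableT fi)).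
apply: (@le_trans _ _ (\int[m]_y trunc_lip k p e)).
  apply: le_Rintegral => //.
  - exact: integrable_norm fi.
  - exact: finite_measure_integrable_cst.
  - by move=> y _; exact: trunc_force_bound.
by rewrite Rintegral_probability_cst.
Qed.

Lemma measurable_trunc_field e : 0 < e ->
  measurable_fun [set: R] (trunc_field e).
Proof.
move=> e0.
have mf : measurable_fun [set: R * R] (fun z : R * R => trunc_force k p e (z.1 - z.2)).
  apply: (measurableT_comp (measurable_trunc_force k_ge0 p_ge0 e0)).
  exact: measurable_funB.
have fi := @bounded_integrable R _ (measurableTypeR R * measurableTypeR R)%type
  (m \x m)%E (trunc_lip k p e) _ mf
  (fun z => trunc_force_bound k_ge0 p_ge0 e0 _).
exact: (measurableT_comp (fine_measurable measurableT) (measurable_fubini_F fi)).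
Qed.

Variables (rho : R -> R) (M : R).
Hypothesis rho_ge0 : forall x, 0 <= rho x.
Hypothesis mrho : measurable_fun [set: R] rho.
Hypothesis m_density : forall A : set (measurableTypeR R), measurable A ->
  (m A = \int[leb]_(x in A) (rho x)%:E)%E.
Hypothesis rho_le : {ae leb, forall x, rho x <= M}.

Lemma trunc_potential_taylor e x h : 0 < e ->
  `|trunc_potential e (x + h) - trunc_potential e x - h * trunc_field e x|
  <= (trunc_slope_lip k p e + 4 * trunc_lip k p e * M) * h ^+ 2.
Proof.
move=> e0.
have ik := integrable_trunc_kernel _ e0; have iF := integrable_trunc_force x e0.
pose r y := trunc_kernel w k p e (x + h - y) - trunc_kernel w k p e (x - y)
  - h * trunc_force k p e (x - y).
have ihF : m.-integrable [set: R] (EFin \o (fun y => h * trunc_force k p e (x - y))).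
  rewrite (_ : _ \o _ = (fun y => h%:E * (trunc_force k p e (x - y))%:E)%E)//.
  exact: integrableZl.
have ikk : m.-integrable [set: R] (EFin \o (fun y =>
    trunc_kernel w k p e (x + h - y) - trunc_kernel w k p e (x - y))).
  exact: integrableB (ik _) (ik _).
have ir : m.-integrable [set: R] (EFin \o r) by exact: integrableB ikk ihF.
have -> : trunc_potential e (x + h) - trunc_potential e x - h * trunc_field e x
    = \int[m]_y r y.
  rewrite /r RintegralB// RintegralB//.
  by rewrite RintegralZl.
apply: (le_trans (le_normr_Rintegral measurableT ir)).
pose i y : R := \1_(`[x - `|h|, x + `|h|]%classic) y.
have mi : measurable_fun [set: R] i by exact: measurable_indic.
have ii : m.-integrable [set: R] (EFin \o i).
  apply: (@bounded_integrable R _ _ m 1) => // y.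
  by rewrite /i indicE; case: (_ \in _); rewrite ?normr1 ?normr0.
have iZ c : m.-integrable [set: R] (EFin \o (fun y => c * i y)).
  rewrite (_ : _ \o _ = (fun y => c%:E * (i y)%:E)%E)//.
  exact: integrableZl.
have bound y : `|r y| <= trunc_slope_lip k p e * h ^+ 2
    + 2 * trunc_lip k p e * `|h| * i y.
  have := @trunc_kernel_taylor R w k p k_ge0 p_ge0 w_tangent e e0 (x - y) h.
  rewrite /r; have -> : x - y + h = x + h - y by ring.
  move=> /le_trans; apply; rewrite lerD2l ler_wpM2l//.
    by rewrite mulr_ge0// mulr_ge0// trunc_lip_ge0.
  rewrite /i indicE ler_nat; case: (leP `|x - y| `|h|) => // /[!ler_norml] xy.
  by rewrite mem_set//= in_itv/=; lra.
have Ii : \int[m]_y i y <= 2 * M * `|h|.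
  have := @integral_density_le R m rho rho_ge0 mrho m_density M rho_le (EFin \o i).
  have -> : (\int[leb]_y (EFin \o i) y)%E = (2 * `|h|)%:E.
    rewrite integral_indic// setIT.
    rewrite [LHS](lebesgue_measure_itv `[x - `|h|, x + `|h|]%R)/= lte_fin.
    case: ifPn => [_|]; first by rewrite -EFinB; congr EFin; ring.
    rewrite -leNgt => hh; have h0 := normr_ge0 h.
    by have -> : `|h| = 0; [lra|rewrite mulr0].
  move=> H; have := H _ _; rewrite -EFinM /Rintegral => {}H.
  rewrite -lee_fin fineK; last exact: integrable_fin_num.
  apply: le_trans (H _ _) _; last by rewrite lee_fin; lra.
  - exact/measurable_EFinP.
  - by move=> y; rewrite lee_fin /i.
apply: (@le_trans _ _ (\int[m]_y (trunc_slope_lip k p e * h ^+ 2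
    + 2 * trunc_lip k p e * `|h| * i y))).
  apply: le_Rintegral => //; first exact: integrable_norm ir.
  exact: (integrableD measurableT
    (finite_measure_integrable_cst m _ measurableT) (iZ _)).
rewrite RintegralD//; last exact: finite_measure_integrable_cst.
rewrite Rintegral_probability_cst RintegralZl// -(real_normK (num_real h)).
have : (trunc_lip k p e * `|h|) * \int[m]_y i y <= (trunc_lip k p e * `|h|) * (2 * M * `|h|).
  by rewrite ler_wpM2l// mulr_ge0// trunc_lip_ge0.
lra.
Qed.

End Potential.

Section FieldCauchy.
Variables (R : realType) (k p : R).
Hypotheses (k_ge0 : 0 <= k) (p_ge0 : 0 <= p).
Variables (m : probability (measurableTypeR R) R) (rho : R -> R) (C alpha : R).
Local Notation leb := (@lebesgue_measure R).
Hypothesis rho_ge0 : forall x, 0 <= rho x.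
Hypothesis rho_int : leb.-integrable [set: R] (EFin \o rho).
Hypothesis m_density : forall A : set (measurableTypeR R), measurable A ->
  (m A = \int[leb]_(x in A) (rho x)%:E)%E.
Hypothesis rho_hoelder : forall x y, `|rho x - rho y| <= C * `|x - y| `^ alpha.
Hypothesis alpha_gt : -1 < alpha - p.

Let mrho : measurable_fun [set: R] rho.
Proof. by apply/measurable_EFinP; exact: measurable_int rho_int. Qed.

Definition field_modulus e : R :=
  k * C * (2 * (e `^ (1 + (alpha - p)) / (1 + (alpha - p)))).

(* Near the diagonal the odd kernel integrates to 0, so rho y may be replaced
   by rho y - rho x. *)
Lemma trunc_field_cauchy d e x : 0 < d -> d <= e ->
  `|trunc_field k p m d x - trunc_field k p m e x| <= field_modulus e.
Proof.
move=> d0 de; have e0 := lt_le_trans d0 de.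
have C0 : 0 <= C.
  have := rho_hoelder 0 1; rewrite sub0r normrN1 powR1 mulr1.
  exact: le_trans.
have msub : measurable_fun [set: R] (fun y : R => x - y) by exact: measurable_funB.
have mF c : 0 < c -> measurable_fun [set: R] (fun y => trunc_force k p c (x - y)).
  by move=> c0; exact: (measurableT_comp (measurable_trunc_force k_ge0 p_ge0 c0) msub).
pose kap z := trunc_force k p d z - trunc_force k p e z.
have mkap : measurable_fun [set: R] kap.
  by apply: measurable_funB; exact: measurable_trunc_force.
have mkapx : measurable_fun [set: R] (fun y => kap (x - y)).
  exact: (measurableT_comp mkap msub).
pose B := trunc_lip k p d + trunc_lip k p e.
have kapB z : `|kap z| <= B * \1_(`[- e, e]%classic) z.
  have := @trunc_force_diff R k p k_ge0 p_ge0 e d z d0 de.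
  rewrite indicE; case: (boolP (z \in _)) => [_ _|].
    rewrite mulr1; apply: (le_trans (ler_normB _ _)).
    by apply: lerD; exact: trunc_force_bound.
  rewrite mem_setE in_itv/= -ler_norml -ltNge => ze.
  by rewrite mulr0 (ltNge `|z|) (ltW ze) andbF mul0r.
have ikap : leb.-integrable [set: R] (EFin \o kap).
  have : leb.-integrable [set: R] (EFin \o (fun z => B * \1_(`[- e, e]%classic) z)).
    rewrite (_ : _ \o _ = (fun y => B%:E * (\1_(`[- e, e]%classic) y)%:E)%E)//.
    by apply: integrableZl => //; exact: integrable_indic_itv.
  apply: le_integrable => //; first exact/measurable_EFinP.
  by move=> z _ /=; rewrite lee_fin (le_trans (kapB z))// ler_norm.
have kapN z : kap (- z) = - kap z by rewrite /kap !trunc_forceN; ring.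
have kap0 : (\int[leb]_y (kap (x - y))%:E = 0)%E.
  rewrite (@integral_reflect R x (fun y => (kap y)%:E)); last exact/measurable_EFinP.
  apply: integral_odd_eq0 => //; first exact/measurable_EFinP.
  by move=> y; rewrite kapN.
have ikapx : leb.-integrable [set: R] (EFin \o (fun y => kap (x - y))).
  apply/integrableP; split; first exact/measurable_EFinP.
  rewrite (@integral_reflect R x (fun y => `|(kap y)%:E|)%E).
    by have /integrableP[] := ikap.
  by apply: measurableT_comp => //; exact/measurable_EFinP.
have ikaprho : leb.-integrable [set: R] (EFin \o (fun y => kap (x - y) * rho y)).
  have : leb.-integrable [set: R] (EFin \o (fun y => B * rho y)).
    rewrite (_ : _ \o _ = (fun y => B%:E * (rho y)%:E)%E)//.
    exact: integrableZl.
  apply: le_integrable => //.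
    by apply/measurable_EFinP; exact: measurable_funM.
  move=> y _ /=; rewrite lee_fin !normrM ler_pM// (le_trans (kapB _))//.
  rewrite (le_trans _ (ler_norm B))// ler_piMr//.
  by rewrite addr_ge0// trunc_lip_ge0.
have fieldE : trunc_field k p m d x - trunc_field k p m e x
    = fine (\int[leb]_y (kap (x - y) * (rho y - rho x))%:E)%E.
  rewrite /trunc_field -RintegralB//; [|exact: integrable_trunc_force..].
  rewrite /Rintegral (integral_density rho_ge0)//; last exact/measurable_EFinP.
  congr fine; transitivity
      (\int[leb]_y ((kap (x - y) * rho y)%:E - (rho x)%:E * (kap (x - y))%:E))%E.
    rewrite integralB//; last exact: integrableZl.
    by rewrite integralZl// kap0 mule0 sube0.
  by apply: eq_integral => y _; rewrite -EFinM -EFinB; congr EFin; ring.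
have ifin : leb.-integrable [set: R] (EFin \o (fun y => kap (x - y) * (rho y - rho x))).
  rewrite (_ : _ \o _ = (fun y => (kap (x - y) * rho y)%:E - (rho x)%:E * (kap (x - y))%:E)%E).
    by apply: integrableB => //; exact: integrableZl.
  by apply/funext => y; rewrite -EFinM -EFinB; congr EFin; ring.
rewrite fieldE -lee_fin EFin_normr_Rintegral//.
apply: (le_trans (le_abse_integral _ _ _)) => //.
  exact: measurable_int ifin.
apply: (@le_trans _ _ (\int[leb]_y ((k * C)%:E * (punctured_powR (alpha - p) e (x - y))%:E))%E).
  apply: ge0_le_integral => //.
  - by apply: measurableT_comp => //; exact: measurable_int ifin.
  - apply: measurable_funeM; apply/measurable_EFinP.
    exact: (measurableT_comp (measurable_punctured_powR _ _) msub).
  - move=> y _ /=; rewrite lee_fin normrM /punctured_powR.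
    have := @trunc_force_diff R k p k_ge0 p_ge0 e d (x - y) d0 de.
    case: (boolP (0 < `|x - y| < e)) => [/andP[xy _]|_]/=; last first.
      rewrite !mul0r mulr0 => H.
      have -> : `|kap (x - y)| = 0 by apply/eqP; rewrite eq_le H normr_ge0.
      by rewrite mul0r.
    rewrite !mul1r => H.
    rewrite powRD ?(gt_eqF xy) ?implybT//.
    have H2 : `|rho y - rho x| <= C * `|x - y| `^ alpha by rewrite distrC.
    rewrite (_ : k * C * _ = (k * `|x - y| `^ (- p)) * (C * `|x - y| `^ alpha)).
      by apply: ler_pM.
    by ring.
rewrite ge0_integralZl//; first last.
- by rewrite lee_fin mulr_ge0.
- by move=> y _; rewrite lee_fin punctured_powR_ge0.
- by apply/measurable_EFinP; exact: (measurableT_comp (measurable_punctured_powR _ _) msub).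
rewrite [X in (_ <= X)%E]EFinM.
apply: lee_wpmul2l; first by rewrite lee_fin mulr_ge0.
exact: integral_punctured_powR.
Qed.

End FieldCauchy.

Section ProductIntegrability.
Variables (R : realType) (d1 d2 : measure_display).
Variables (T1 : measurableType d1) (T2 : measurableType d2).
Variables (P1 : probability T1 R) (P2 : probability T2 R).

Lemma integrable_prod_fst (f : T1 -> R) : P1.-integrable [set: T1] (EFin \o f) ->
  (P1 \x P2)%E.-integrable [set: T1 * T2] (EFin \o (f \o fst)).
Proof.
move=> fi; have mf : measurable_fun [set: T1] f.
  by apply/measurable_EFinP; exact: measurable_int fi.
apply/integrable12ltyP.
  by apply/measurable_EFinP; exact: (measurableT_comp mf).
rewrite (eq_integral (fun x => `|(f x)%:E|)%E); first by have /integrableP[] := fi.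
move=> x _; transitivity (`|(f x)%:E| * P2 setT)%E; first by rewrite -integral_cst.
by rewrite probability_setT mule1.
Qed.

Lemma integrable_prod_snd (f : T2 -> R) : P2.-integrable [set: T2] (EFin \o f) ->
  (P1 \x P2)%E.-integrable [set: T1 * T2] (EFin \o (f \o snd)).
Proof.
move=> fi; have mf : measurable_fun [set: T2] f.
  by apply/measurable_EFinP; exact: measurable_int fi.
apply/integrable21ltyP.
  by apply/measurable_EFinP; exact: (measurableT_comp mf).
rewrite (eq_integral (fun x => `|(f x)%:E|)%E); first by have /integrableP[] := fi.
move=> x _; transitivity (`|(f x)%:E| * P1 setT)%E; first by rewrite -integral_cst.
by rewrite probability_setT mule1.
Qed.

End ProductIntegrability.

Section TruncatedInteraction.
Variables (R : realType) (w : R -> R) (k p : R).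
Hypotheses (k_ge0 : 0 <= k) (p_ge0 : 0 <= p).
Hypothesis w_tangent : forall a b : R, 0 < a -> 0 < b ->
  w a - k * a `^ (- p) * (b - a) <= w b.

Lemma integrable_trunc_interaction d (T : measurableType d) (P : probability T R)
    (Z : T -> R) (e : R) : 0 < e -> P.-integrable setT (EFin \o Z) ->
  (P \x P)%E.-integrable setT
    (EFin \o (fun z : T * T => trunc_kernel w k p e (Z z.1 - Z z.2))).
Proof.
move=> e0 Zi.
have isub : (P \x P)%E.-integrable setT (EFin \o (fun z : T * T => Z z.1 - Z z.2)).
  exact: (RintegrableB (integrable_prod_fst P Zi) (integrable_prod_snd P Zi)).
exact: (lipschitz_integrable (trunc_kernel_lipschitz k_ge0 p_ge0 w_tangent e0) isub).
Qed.

End TruncatedInteraction.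

Section KernelRemainder.
Variables (R : realType) (w : R -> R) (k p K a : R) (W : R -> \bar R).
Implicit Types e x z : R.
Hypotheses (k_ge0 : 0 <= k) (p_ge0 : 0 <= p).
Hypothesis w_tangent : forall a b : R, 0 < a -> 0 < b ->
  w a - k * a `^ (- p) * (b - a) <= w b.
Hypothesis mW : measurable_fun [set: R] W.
Hypothesis WE : forall z, z != 0 -> W z = (w `|z|)%:E.
Hypothesis W0 : forall e, 0 < e -> ((trunc_kernel w k p e 0)%:E <= W 0)%E.
Hypotheses (K_ge0 : 0 <= K) (a_gt : -1 < a).
Hypothesis w_singular : forall x e, 0 < x -> x < e -> e <= 1 ->
  w x - w e <= K * x `^ a.
Local Notation leb := (@lebesgue_measure R).

Lemma trunc_kernel_le e z : 0 < e -> ((trunc_kernel w k p e z)%:E <= W z)%E.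
Proof.
move=> e0; have [->|z0] := eqVneq z 0; first exact: W0.
by rewrite WE// lee_fin; apply: trunc_profile_le => //; rewrite normr_gt0.
Qed.

Let rem e z : \bar R := (W z - (trunc_kernel w k p e z)%:E)%E.

Let rem_ge0 e z : 0 < e -> (0 <= rem e z)%E.
Proof. by move=> e0; rewrite /rem sube_ge0 ?trunc_kernel_le. Qed.

Let rem_le e z : 0 < e -> e <= 1 -> z != 0 ->
  (rem e z <= (K * punctured_powR a e z)%:E)%E.
Proof.
move=> e0 e1 z0; rewrite /rem WE// -EFinB lee_fin /punctured_powR.
have zp : 0 < `|z| by rewrite normr_gt0.
rewrite zp/=; have [ze|ez] := ltP `|z| e.
  rewrite mul1r; apply: le_trans (w_singular zp ze e1).
  rewrite /trunc_kernel trunc_profileE'; last exact: ltW.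
  have : 0 <= trunc_lip k p e * (e - `|z|).
    by rewrite mulr_ge0 ?trunc_lip_ge0// subr_ge0 ltW.
  by move=> ?; lra.
by rewrite /trunc_kernel trunc_profileE// subrr mul0r mulr0.
Qed.

Let mrem e : 0 < e -> measurable_fun [set: R] (rem e).
Proof.
move=> e0; apply: emeasurable_funB => //; apply/measurable_EFinP.
exact: measurable_trunc_kernel.
Qed.

Variables (m : probability (measurableTypeR R) R) (rho : R -> R) (M : R).
Hypothesis m_moment : m.-integrable [set: R] (EFin \o @id R).
Hypothesis rho_ge0 : forall x, 0 <= rho x.
Hypothesis mrho : measurable_fun [set: R] rho.
Hypothesis m_density : forall A : set (measurableTypeR R), measurable A ->
  (m A = \int[leb]_(x in A) (rho x)%:E)%E.
Hypothesis rho_le : {ae leb, forall x, rho x <= M}.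

Definition potential_modulus e : R :=
  M * (K * (2 * (e `^ (1 + a) / (1 + a)))).

Let msub (x : R) : measurable_fun [set: R] (fun y : R => x - y).
Proof. exact: measurable_funB. Qed.

Let integral_rem e x : 0 < e -> e <= 1 ->
  (\int[m]_y rem e (x - y)%R <= (potential_modulus e)%:E)%E.
Proof.
move=> e0 e1.
have mr : measurable_fun [set: R] (fun y => rem e (x - y)).
  exact: (measurableT_comp (mrem e0) (msub x)).
have mpp : measurable_fun [set: R] (fun y => (punctured_powR a e (x - y))%:E).
  apply/measurable_EFinP.
  exact: (measurableT_comp (measurable_punctured_powR _ _) (msub x)).
apply: (le_trans (integral_density_le rho_ge0 mrho m_density rho_le mr _)).
  by move=> y; exact: rem_ge0.
rewrite /potential_modulus EFinM.
have M0 := density_bound_ge0 rho_ge0 mrho m_density rho_le.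
apply: lee_wpmul2l; first by rewrite lee_fin.
apply: (@le_trans _ _ (\int[leb]_y (K%:E * (punctured_powR a e (x - y))%:E))%E).
  apply: ae_ge0_le_integral => //.
  - by move=> y _; exact: rem_ge0.
  - by move=> y _; rewrite -EFinM lee_fin mulr_ge0// punctured_powR_ge0.
  - exact: measurable_funeM.
  - exists [set x]; split => //; first exact: lebesgue_measure_set1.
    move=> y/= H; apply: contrapT => yx; apply: H => _.
    rewrite -EFinM; apply: rem_le => //; rewrite subr_eq0.
    by apply/eqP => xy; apply: yx.
rewrite ge0_integralZl//; first last.
- by move=> y _; rewrite lee_fin punctured_powR_ge0.
rewrite EFinM; apply: lee_wpmul2l; first by rewrite lee_fin.
exact: integral_punctured_powR.
Qed.

Let rem_split e z : 0 < e -> W z = ((trunc_kernel w k p e z)%:E + rem e z)%E.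
Proof. by move=> e0; rewrite /rem addeC subeK. Qed.

Lemma potential_approx e x : 0 < e -> e <= 1 ->
  `|fine (\int[leb]_y (W (x - y)%R * (rho y)%:E))%E - trunc_potential w k p m e x|
  <= potential_modulus e.
Proof.
move=> e0 e1.
have mr : measurable_fun [set: R] (fun y => rem e (x - y)).
  exact: (measurableT_comp (mrem e0) (msub x)).
have ir : m.-integrable [set: R] (fun y => rem e (x - y)).
  apply/integrableP; split => //.
  under eq_integral do rewrite gee0_abs ?rem_ge0//.
  by apply: le_lt_trans (integral_rem x e0 e1) _; rewrite ltry.
have ik := integrable_trunc_kernel k_ge0 p_ge0 w_tangent m_moment x e0.
rewrite -(integral_density rho_ge0 mrho m_density); last first.
  exact: (measurableT_comp mW (msub x)).
under eq_integral do rewrite (rem_split _ e0).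
rewrite integralD// fineD; [|exact: integrable_fin_num..].
rewrite /trunc_potential /Rintegral addrC addrA.
rewrite (_ : forall u v : R, - u + u + v = v); last by move=> u v; ring.
rewrite ger0_norm; last by apply/fine_ge0/integral_ge0 => y _; exact: rem_ge0.
by rewrite -lee_fin fineK ?integral_rem//; exact: integrable_fin_num.
Qed.

Lemma interaction_le e : 0 < e -> e <= 1 ->
  (\int[m \x m]_z W (z.1 - z.2)%R <=
   \int[m \x m]_z (trunc_kernel w k p e (z.1 - z.2)%R)%:E
    + (potential_modulus e)%:E)%E.
Proof.
move=> e0 e1.
have mr : measurable_fun [set: measurableTypeR R * measurableTypeR R]
    (fun z : R * R => rem e (z.1 - z.2)).
  by apply: (measurableT_comp (mrem e0)); exact: measurable_funB.
have r0 (z : measurableTypeR R * measurableTypeR R) : (0 <= rem e (z.1 - z.2)%R)%E.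
  exact: rem_ge0.
have rle : (\int[m \x m]_z rem e (z.1 - z.2)%R <= (potential_modulus e)%:E)%E.
  rewrite (fubini_tonelli1 _ mr r0).
  apply: (@le_trans _ _ (\int[m]_x (cst (potential_modulus e)%:E x))%E).
    apply: ge0_le_integral => //.
    - by move=> x _; apply: integral_ge0 => y _; exact: r0.
    - exact: (measurable_fun_fubini_tonelli_F _ mr r0).
    - by move=> x _; exact: integral_rem.
  by rewrite integral_cst// [X in (_ * X)%E](probability_setT m) mule1.
have ik := integrable_trunc_interaction k_ge0 p_ge0 w_tangent e0 m_moment.
have ir : (m \x m)%E.-integrable setT
    (fun z : measurableTypeR R * measurableTypeR R => rem e (z.1 - z.2)).
  apply/integrableP; split => //.
  under eq_integral do rewrite gee0_abs ?rem_ge0//.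
  by apply: le_lt_trans rle _; rewrite ltry.
under eq_integral do rewrite (rem_split _ e0).
by rewrite integralD//; apply: leeD.
Qed.

End KernelRemainder.

Section UniformDifferentiation.
Variable R : realType.

Definition vanishing (u : R -> R) : Prop := forall eta : R, 0 < eta ->
  exists2 d : R, 0 < d <= 1 & forall e, 0 < e -> e <= d -> u e <= eta.

Lemma vanishing_powR (c q : R) : 0 < q -> vanishing (fun e => c * e `^ q).
Proof.
move=> q0 eta eta0.
have c1 : 0 < `|c| + 1 by rewrite ltr_wpDl.
have b0 : 0 < eta / (`|c| + 1) by rewrite divr_gt0.
exists (Num.min 1 ((eta / (`|c| + 1)) `^ q^-1)).
  by rewrite ge_min lexx andbT lt_min ltr01 powR_gt0.
move=> e e0; rewrite le_min => /andP[_ ed].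
apply: (@le_trans _ _ ((`|c| + 1) * e `^ q)).
  by rewrite ler_wpM2r ?powR_ge0// (le_trans (ler_norm c))// lerDl.
rewrite mulrC -ler_pdivlMr//.
have -> : eta / (`|c| + 1) = ((eta / (`|c| + 1)) `^ q^-1) `^ q.
  by rewrite -powRrM mulVf ?gt_eqF// powRr1// ltW.
by apply: ge0_ler_powR; rewrite ?nnegrE ?powR_ge0// ltW.
Qed.

Lemma vanishing_le0 (u : R -> R) (x : R) : vanishing u ->
  (forall e, 0 < e -> e <= 1 -> x <= u e) -> x <= 0.
Proof.
move=> uv ux; apply/ler_addgt0Pr => eta eta0; rewrite add0r.
have [d /andP[d0 d1] ud] := uv _ eta0.
by apply: (le_trans (ux d d0 d1)); exact: ud.
Qed.

Lemma vanishingD (u v : R -> R) : vanishing u -> vanishing v ->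
  vanishing (fun e => u e + v e).
Proof.
move=> uv vv eta eta0; have eta2 : 0 < eta / 2 by rewrite divr_gt0.
have [d /andP[d0 d1] ud] := uv _ eta2; have [c /andP[c0 c1] vc] := vv _ eta2.
exists (Num.min d c); first by rewrite lt_min d0 c0 ge_min d1.
move=> e e0; rewrite le_min => /andP[ed ec].
by have := lerD (ud e e0 ed) (vc e e0 ec); rewrite -splitr.
Qed.

Lemma vanishingZ (c : R) (u : R -> R) : 0 <= c -> vanishing u ->
  vanishing (fun e => c * u e).
Proof.
move=> c0 uv eta eta0; have c1 : 0 < c + 1 by rewrite ltr_wpDl.
have [d d01 ud] := uv _ (divr_gt0 eta0 c1); exists d => // e e0 ed.
apply: (@le_trans _ _ (c * (eta / (c + 1)))); first by rewrite ler_wpM2l// ud.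
rewrite mulrCA ger_pMr// ler_pdivrMr// mul1r; lra.
Qed.

Section Quotient.
Variables (f : R -> R) (x : R).

Let quotE (h : R) : h^-1 *: ((f \o shift x) (h *: 1) - f x) = (f (x + h) - f x) / h.
Proof. by rewrite /GRing.scale/= mulr1 addrC mulrC [h + x]addrC addrC. Qed.

Lemma derivable_cauchy : (forall eta : R, 0 < eta ->
    exists g, \forall h \near 0^', `|(f (x + h) - f x) / h - g| <= eta) ->
  derivable f x 1.
Proof.
move=> H; apply: cauchy_cvg; apply: cauchy_exP => eta eta0.
have [g Hg] := H (eta / 2) (divr_gt0 eta0 (ltr0n _ 2)).
exists g; rewrite nbhs_simpl/= -ball_normE/=.
near=> h. rewrite /= quotE distrC; apply: (@le_lt_trans _ _ (eta / 2)).
  by near: h.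
by rewrite ltr_pdivrMr// ltr_pMr// ltr1n.
Unshelve. all: by end_near. Qed.

Lemma derive1_dist (g eta : R) : derivable f x 1 ->
  (\forall h \near 0^', `|(f (x + h) - f x) / h - g| <= eta) ->
  `|f^`()%classic x - g| <= eta.
Proof.
move=> df H; apply/ler_addgt0Pr => d d0.
have cf : (f (x + h) - f x) / h @[h --> 0^'] --> f^`()%classic x.
  rewrite derive1E; under eq_fun do rewrite -quotE.
  exact: df.
near (0 : R)^' => h.
have H1 : `|(f (x + h) - f x) / h - g| <= eta by near: h.
have H2 : `|f^`()%classic x - (f (x + h) - f x) / h| <= d.
  by near: h; apply: cvgr_dist_le.
have := ler_distD ((f (x + h) - f x) / h) (f^`()%classic x) g; lra.
Unshelve. all: by end_near. Qed.

End Quotient.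

Lemma quadratic_is_derive (f : R -> R) (x g c : R) :
  (forall h, `|f (x + h) - f x - h * g| <= c * h ^+ 2) -> is_derive x 1 f g.
Proof.
move=> H.
have near_quot eta : 0 < eta ->
    \forall h \near 0^', `|(f (x + h) - f x) / h - g| <= eta.
  move=> eta0; near=> h.
  have h0 : h != 0 by near: h; exact: nbhs_dnbhs_neq.
  have c1 : 0 < `|c| + 1 by rewrite ltr_wpDl.
  have hs : `|h| <= eta / (`|c| + 1).
    by near: h; apply: dnbhs0_le; rewrite divr_gt0.
  have -> : (f (x + h) - f x) / h - g = (f (x + h) - f x - h * g) / h by field.
  rewrite normrM normfV ler_pdivrMr ?normr_gt0//; apply: (le_trans (H h)).
  rewrite -(real_normK (num_real h)) expr2 mulrA ler_wpM2r//.
  apply: (@le_trans _ _ ((`|c| + 1) * `|h|)).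
    by rewrite ler_wpM2r// (le_trans (ler_norm c))// lerDl.
  by rewrite mulrC -ler_pdivlMr.
have df : derivable f x 1 by apply: derivable_cauchy => eta /near_quot; exists g.
apply: DeriveDef => //; rewrite -derive1E; apply/eqP; rewrite -subr_eq0 -normr_le0.
by apply/ler_addgt0Pr => eta eta0; rewrite add0r; apply: derive1_dist => //; exact: near_quot.
Unshelve. all: by end_near. Qed.

Implicit Types d e h x y : R.
Variables (f : R -> R) (F G : R -> R -> R) (c u v : R -> R).
Hypothesis FG : forall e x h, 0 < e ->
  `|F e (x + h) - F e x - h * G e x| <= c e * h ^+ 2.
Hypothesis G_cauchy : forall d e x, 0 < d -> d <= e -> `|G d x - G e x| <= v e.
Hypothesis F_cvg : forall e x, 0 < e -> e <= 1 -> `|f x - F e x| <= u e.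
Hypotheses (u_vanishing : vanishing u) (v_vanishing : vanishing v).

Let F_derive e x : 0 < e -> is_derive x 1 (F e) (G e x).
Proof. by move=> e0; apply: (@quadratic_is_derive _ _ _ (c e)) => h; exact: FG. Qed.

Let FB_lip_ge d e x h : 0 < d -> d <= e -> 0 <= h ->
  `|(F d (x + h) - F e (x + h)) - (F d x - F e x)| <= v e * `|h|.
Proof.
move=> d0 de h0; have e0 := lt_le_trans d0 de.
have dB y : is_derive y 1 (F d \- F e) (G d y - G e y).
  by have := F_derive y d0; have := F_derive y e0 => ? ?; exact: is_deriveB.
have xh : x <= x + h by rewrite lerDl.
have cB : {within `[x, x + h], continuous (F d \- F e)}.
  by apply: derivable_within_continuous => y _; have [] := dB y.
have [c0 _] := MVT_segment xh (fun y _ => dB y) cB.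
rewrite /= => ->; have -> : x + h - x = h by ring.
by rewrite normrM ler_wpM2r// G_cauchy.
Qed.

Let FB_lip d e x h : 0 < d -> d <= e ->
  `|(F d (x + h) - F e (x + h)) - (F d x - F e x)| <= v e * `|h|.
Proof.
move=> d0 de; have [h0|h0] := leP 0 h; first exact: FB_lip_ge.
have := @FB_lip_ge d e (x + h) (- h) d0 de; rewrite addrK normrN distrC.
by apply; rewrite oppr_ge0 ltW.
Qed.

Let f_lip e x h : 0 < e -> e <= 1 ->
  `|(f (x + h) - F e (x + h)) - (f x - F e x)| <= v e * `|h|.
Proof.
move=> e0 e1; rewrite -subr_le0.
apply: (@vanishing_le0 (fun d => 2 * u (Num.min d e))).
  move=> eta eta0; have [d /andP[d0 d1] ud] := vanishingZ (ler0n _ 2) u_vanishing eta0.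
  exists d; first by rewrite d0.
  by move=> b b0 bd; apply: ud; rewrite ?lt_min ?b0// ge_min bd.
move=> d' d'0 d'1; set d := Num.min d' e.
have d0 : 0 < d by rewrite lt_min d'0.
have de : d <= e by rewrite ge_min lexx orbT.
have H1 := FB_lip x h d0 de.
have H2 := F_cvg (x + h) d0 (le_trans de e1).
have H3 := F_cvg x d0 (le_trans de e1).
have := ler_normD (f (x + h) - F d (x + h)) (- (f x - F d x)).
rewrite normrN => H4.
have := ler_normD ((f (x + h) - F d (x + h)) - (f x - F d x))
  ((F d (x + h) - F e (x + h)) - (F d x - F e x)).
have -> : f (x + h) - F d (x + h) - (f x - F d x) +
   (F d (x + h) - F e (x + h) - (F d x - F e x)) =
   f (x + h) - F e (x + h) - (f x - F e x) by ring.
by lra.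
Qed.

Let near_quot e x eta : 0 < e -> e <= 1 -> 0 < eta ->
  \forall h \near 0^', `|(f (x + h) - f x) / h - G e x| <= v e + eta.
Proof.
move=> e0 e1 eta0; near=> h.
have h0 : h != 0 by near: h; exact: nbhs_dnbhs_neq.
have c1 : 0 < `|c e| + 1 by rewrite ltr_wpDl.
have hs : `|h| <= eta / (`|c e| + 1).
  by near: h; apply: dnbhs0_le; rewrite divr_gt0.
have -> : (f (x + h) - f x) / h - G e x =
    ((f (x + h) - F e (x + h)) - (f x - F e x) +
     (F e (x + h) - F e x - h * G e x)) / h by field.
rewrite normrM normfV ler_pdivrMr ?normr_gt0//.
apply: (le_trans (ler_normD _ _)); rewrite mulrDl; apply: lerD.
  exact: f_lip.
apply: (le_trans (FG x h e0)).
rewrite -(real_normK (num_real h)) expr2 mulrA ler_wpM2r//.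
apply: (@le_trans _ _ ((`|c e| + 1) * `|h|)).
  by rewrite ler_wpM2r// (le_trans (ler_norm _))// lerDl.
by rewrite mulrC -ler_pdivlMr.
Unshelve. all: by end_near. Qed.

Lemma uniform_limit_derivable x : derivable f x 1.
Proof.
apply: derivable_cauchy => eta eta0.
have eta2 : 0 < eta / 2 by rewrite divr_gt0.
have [d /andP[d0 d1] vd] := v_vanishing eta2.
exists (G d x); apply: filterS (near_quot x d0 d1 eta2) => h /le_trans; apply.
by rewrite {2}(splitr eta) lerD2r vd.
Qed.

Lemma uniform_limit_derive1 e x : 0 < e -> e <= 1 ->
  `|f^`()%classic x - G e x| <= v e.
Proof.
move=> e0 e1; apply/ler_addgt0Pr => eta eta0.
by apply: derive1_dist; [exact: uniform_limit_derivable|exact: near_quot].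
Qed.

End UniformDifferentiation.

(** * Monotone transport *)

Section DistributionFunction.
Variables (R : realType) (P : probability (measurableTypeR R) R).
Implicit Types x y c : R.

Definition dfun x : R := fine (P `]-oo, x]%classic).

Let idR : measurableTypeR R -> R := idfun.

#[local] HB.instance Definition _ :=
  @isMeasurableFun.Build _ _ _ _ idR (@measurable_id _ _ setT).

Let cdf_idE x : cdf (idR : {RV P >-> R}) x = P `]-oo, x]%classic.
Proof. by rewrite /cdf/= /distribution /pushforward preimage_id. Qed.

Lemma dfunE x : P `]-oo, x]%classic = (dfun x)%:E.
Proof. by rewrite /dfun fineK// fin_num_measure. Qed.

Lemma dfun_ge0 x : 0 <= dfun x.
Proof. by rewrite -lee_fin -dfunE. Qed.

Lemma dfun_le1 x : dfun x <= 1.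
Proof. by rewrite -lee_fin -dfunE probability_le1. Qed.

Lemma dfun_nd : {homo dfun : x y / x <= y}.
Proof.
move=> x y xy; rewrite -lee_fin -!dfunE le_measure ?inE//.
exact: subset_itvl.
Qed.

Lemma measurable_dfun : measurable_fun [set: R] dfun.
Proof. by apply: nondecreasing_measurable => // x y; exact: dfun_nd. Qed.

Lemma dfun_cvgy : dfun x @[x --> +oo] --> (1 : R).
Proof.
apply: fine_cvg; have := cvg_cdfy1 (idR : {RV P >-> R}).
by apply: cvg_trans; apply: near_eq_cvg; near=> x; rewrite cdf_idE.
Unshelve. all: by end_near. Qed.

Lemma dfun_cvgNy : dfun x @[x --> -oo] --> (0 : R).
Proof.
apply: fine_cvg; have := cvg_cdfNy0 (idR : {RV P >-> R}).
by apply: cvg_trans; apply: near_eq_cvg; near=> x; rewrite cdf_idE.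
Unshelve. all: by end_near. Qed.

Lemma dfun_gt c : c < 1 -> exists y, c < dfun y.
Proof.
move=> c1; have : \forall y \near +oo, c < dfun y by apply: (cvgr_gt 1 dfun_cvgy).
by move=> /filter_ex[y]; exists y.
Qed.

Lemma dfun_lt c : 0 < c -> exists y, dfun y < c.
Proof.
move=> c1; have : \forall y \near -oo, dfun y < c by apply: (cvgr_lt 0 dfun_cvgNy).
by move=> /filter_ex[y]; exists y.
Qed.

Lemma dfun_right c x : (forall y, x < y -> c <= dfun y) -> c <= dfun x.
Proof.
move=> H; rewrite -lee_fin -dfunE -cdf_idE.
have := @cdf_right_continuous _ _ _ _ (idR : {RV P >-> R}) x.
apply: cvge_ge; near=> y; rewrite cdf_idE dfunE lee_fin; apply: H.
by near: y; exact: nbhs_right_gt.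
Unshelve. all: by end_near. Qed.

Lemma dfun_left c x : (forall y, y < x -> dfun y <= c) ->
  (P `]-oo, x[%classic <= c%:E)%E.
Proof.
move=> H; pose F n := `]-oo, x - n.+1%:R^-1]%classic.
have -> : `]-oo, x[%classic = \bigcup_n F n.
  apply/seteqP; split => [y/=|y [n _]/=]; rewrite /F/= !in_itv/=.
    move=> yx; have yx0 : 0 < x - y by rewrite subr_gt0.
    have [n nyx] := filter_ex (near_infty_natSinv_lt (PosNum yx0)).
    have {}nyx : n.+1%:R^-1 < x - y := nyx.
    by exists n => //=; rewrite in_itv/= lerBrDr addrC -lerBrDr ltW.
  by move=> /le_lt_trans; apply; rewrite gtrBl invr_gt0.
have := @nondecreasing_cvg_mu _ _ _ P F.
have mF n : measurable (F n) by exact: measurable_itv.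
have ndF : nondecreasing_seq F.
  move=> n p np; apply/subsetPset; apply: subset_itvl.
  by rewrite bnd_simp lerD2l lerN2 lef_pV2 ?posrE// ler_nat.
move=> /(_ mF (bigcup_measurable (fun n _ => mF n)) ndF).
apply: cvge_le; apply: nearW => n /=.
by rewrite dfunE lee_fin H// gtrBl invr_gt0.
Qed.

End DistributionFunction.

Section Uniqueness.
Variables (R : realType) (P Q : probability (measurableTypeR R) R).

Lemma eq_probability_dfun : (forall y : R, P `]-oo, y]%classic = Q `]-oo, y]%classic) ->
  forall A : set (measurableTypeR R), measurable A -> P A = Q A.
Proof.
move=> PQ A mA.
apply: (@measure_unique _ R (measurableTypeR R) (@RGenOInfty.G R)
  (fun n => `]- n%:R, +oo[%classic) _ _ _ _ P Q) => //.
- exact: RGenOInfty.measurableE.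
- move=> _ _ [x ->] [y ->]; exists (Num.max x y).
  by apply/seteqP; split => z/=; rewrite !in_itv/= !andbT gt_max => /andP.
- by move=> n; exists (- n%:R).
- apply/seteqP; split => // x _; exists (Num.bound `|- x|) => //=.
  rewrite in_itv/= andbT ltrNl; apply: le_lt_trans (ler_norm _) _.
  exact: archi_boundP.
- move=> _ [x ->]; have -> : `]x, +oo[%classic = ~` `]-oo, x]%classic by rewrite setCitvl.
  by rewrite [LHS](probability_setC P)// [RHS](probability_setC Q)// PQ.
- by move=> n; rewrite (le_lt_trans (probability_le1 _ _))// ltry.
Qed.

End Uniqueness.

Section MonotoneTransport.
Variables (R : realType) (m nu : probability (measurableTypeR R) R).
Hypothesis m_atomless : forall x : R, m [set x] = 0%E.
Local Notation F := (dfun m).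
Local Notation N := (dfun nu).

Let mF : measurable_fun [set: R] F. Proof. exact: measurable_dfun. Qed.

Let m_sublevel_oo (u : R) : 0 < u < 1 -> m [set x | F x <= u] = u%:E.
Proof.
move=> /andP[u0 u1]; pose A := [set x | F x <= u].
have [y0 y0u] := dfun_lt m u0; have [y1 y1u] := dfun_gt m u1.
have Aub : ubound A y1.
  move=> x /= xu; rewrite leNgt; apply/negP => /ltW/(dfun_nd m) h.
  by have := le_lt_trans (le_trans h xu) y1u; rewrite ltxx.
have A0 : A !=set0 by exists y0; exact: ltW.
have supA : has_sup A by split => //; exists y1.
set z := sup A.
have below y : y < z -> F y <= u.
  move=> yz; have [x Ax yx] := sup_gt A0 yz.
  by apply: le_trans Ax; apply: dfun_nd; exact: ltW.
have Fz_ge : u <= F z.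
  apply: dfun_right => y zy; apply/ltW; rewrite ltNge; apply/negP => Ay.
  by have := ub_le_sup (ex_intro _ _ Aub) Ay; rewrite leNgt zy.
have Fz_le : F z <= u.
  rewrite -lee_fin -dfunE.
  have -> : `]-oo, z]%classic = `]-oo, z[%classic `|` [set z].
    apply/seteqP; split => x/=; rewrite !in_itv/= le_eqVlt.
      by move=> /orP[/eqP|]; [right|left].
    by move=> [->|->]; rewrite ?eqxx ?orbT.
  rewrite measureU//; last first.
    by apply/seteqP; split => // x [] /=; rewrite in_itv/= => /[swap] ->; rewrite ltxx.
  rewrite [X in (_ + X <= _)%E](m_atomless z) adde0.
  by apply: dfun_left => y; exact: below.
have -> : [set x | F x <= u] = `]-oo, z]%classic.
  apply/seteqP; split => x /=; rewrite in_itv/=.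
    by move=> xu; exact: (ub_le_sup (ex_intro _ _ Aub)).
  by move=> xz; apply: le_trans Fz_le; exact: dfun_nd.
by rewrite dfunE; congr EFin; apply/eqP; rewrite eq_le Fz_le.
Qed.

Let measurable_sublevel (u : R) : measurable [set x : measurableTypeR R | F x <= u].
Proof.
rewrite (_ : [set x | _] = F @^-1` `]-oo, u]%classic); last first.
  by apply/seteqP; split => x /=; rewrite in_itv.
by rewrite -[X in measurable X]setTI; exact: mF.
Qed.

Let m_sublevel0 : m [set x | F x <= 0] = 0%E.
Proof.
apply/eqP; rewrite eq_le measure_ge0 andbT; apply/lee_addgt0Pr => e e0.
rewrite add0e; pose u := Num.min e 2^-1.
have u0 : 0 < u by rewrite lt_min e0 invr_gt0 ltr0n.
have ue : u <= e by rewrite ge_min lexx.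
have u1 : u < 1 by rewrite gt_min invf_lt1 ?ltr1n ?orbT// ltr0n.
apply: (@le_trans _ _ u%:E); last by rewrite lee_fin.
rewrite -m_sublevel_oo ?u0//; apply: le_measure; rewrite ?inE.
- exact: measurable_sublevel.
- exact: measurable_sublevel.
- by move=> x /= h; exact: le_trans h (ltW u0).
Qed.

Let m_sublevel (u : R) : 0 <= u <= 1 -> m [set x | F x <= u] = u%:E.
Proof.
move=> /andP[]; rewrite le_eqVlt => /predU1P[<- _|u0]; first exact: m_sublevel0.
rewrite le_eqVlt => /predU1P[->|u1]; last by rewrite m_sublevel_oo// u0.
rewrite (_ : [set x | _] = setT) ?probability_setT//.
by apply/seteqP; split => // x _ /=; exact: dfun_le1.
Qed.

Let S := [set x : measurableTypeR R | 0 < F x < 1].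

Let mS : measurable S.
Proof.
rewrite (_ : S = F @^-1` `]0, 1[%classic); last first.
  by apply/seteqP; split => x /=; rewrite in_itv.
by rewrite -[X in measurable X]setTI; exact: mF.
Qed.

Let m_setCS : m (~` S) = 0%E.
Proof.
apply/eqP; rewrite eq_le measure_ge0 andbT; apply/lee_addgt0Pr => e e0.
rewrite add0e; pose u := 1 - Num.min e 2^-1.
have v0 : 0 < Num.min e 2^-1 by rewrite lt_min e0 invr_gt0 ltr0n.
have ue : 1 - u <= e by rewrite /u opprB addrC subrK ge_min lexx.
have u0 : 0 <= u.
  by rewrite subr_ge0 ge_min invf_le1 ?ler1n ?orbT// ltr0n.
have u1 : u < 1 by rewrite ltrBlDr ltrDl.
have u01 : 0 <= u <= 1 by rewrite u0 ltW.
apply: (@le_trans _ _ (m [set x | (F x <= 0)%R] + m (~` [set x | (F x <= u)%R]))%E).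
  apply: (@le_trans _ _ (m ([set x | (F x <= 0)%R] `|` ~` [set x | (F x <= u)%R]))).
    apply: le_measure; rewrite ?inE.
    - exact: measurableC.
    - by apply: measurableU; [|apply: measurableC]; exact: measurable_sublevel.
    - move=> x /= /negP; rewrite negb_and -!leNgt => /orP[|h]; [by left|right => h2].
      by have := lt_le_trans u1 (le_trans h h2); rewrite ltxx.
  by apply: measureU2; rewrite ?inE; [|apply: measurableC]; exact: measurable_sublevel.
rewrite [X in (X + _)%E]m_sublevel0 add0e.
rewrite [leLHS](probability_setC m); last exact: measurable_sublevel.
by rewrite [X in (_ - X)%E](m_sublevel u01) -EFinB lee_fin.
Qed.

Let T x := inf [set y | F x <= N y].

Let T_le x y : S x -> (T x <= y) = (F x <= N y).
Proof.
move=> /andP[F0 F1].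
have A0 : [set y | F x <= N y] !=set0.
  by have [y1 y1F] := dfun_gt nu F1; exists y1; exact: ltW.
have Alb : has_lbound [set y | F x <= N y].
  have [y0 y0F] := dfun_lt nu F0; exists y0 => z /= Fz; rewrite leNgt.
  apply/negP => /ltW/(dfun_nd nu) h; have := lt_le_trans y0F (le_trans Fz h).
  by rewrite ltxx.
apply/idP/idP => [Ty|]; last by move=> h; exact: (ge_inf Alb).
apply: dfun_right => z yz; have [z' /= Fz' z'z] := inf_lt A0 (le_lt_trans Ty yz).
by apply: le_trans Fz' _; apply: dfun_nd; exact: ltW.
Qed.

Let ae_S (A B : set (measurableTypeR R)) : measurable A -> measurable B ->
  A `&` S = B `&` S -> m A = m B.
Proof.
have mI C : measurable C -> m C = m (C `&` S).
  move=> mC; have mCS : measurable (C `&` ~` S).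
    by apply: measurableI => //; exact: measurableC.
  have CS0 : m (C `&` ~` S) = 0%E.
    apply/eqP; rewrite eq_le measure_ge0 andbT -m_setCS le_measure ?inE//.
    exact: measurableC.
  rewrite -{1}(setIT C) -(setUv S) setIUr.
  rewrite [LHS]measureU//; [|exact: measurableI|].
    by rewrite [X in (_ + X)%E]CS0 adde0.
  by rewrite setIACA setICr setI0.
by move=> mA mB AB; rewrite (mI A)// (mI B)// AB.
Qed.

(* inf is junk where F is 0 or 1; there, on a null set, X is constant instead of
   the identity, which makes (X, Y) comonotone everywhere. *)
Lemma monotone_transport : exists X Y : measurableTypeR R -> measurableTypeR R,
  [/\ measurable_fun [set: measurableTypeR R] X, measurable_fun [set: measurableTypeR R] Y,
   forall A : set (measurableTypeR R), measurable A -> pushforward m X A = m A,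
   forall A : set (measurableTypeR R), measurable A -> pushforward m Y A = nu A &
   (forall s t, X s = X t -> Y s = Y t) /\ (forall s t, X s <= X t -> Y s <= Y t)].
Proof.
have [x0 Sx0] : S !=set0.
  apply/set0P/eqP => S0; have := m_setCS; rewrite S0 setC0 probability_setT.
  by move/eqP; rewrite eqe oner_eq0.
pose X (x : measurableTypeR R) : measurableTypeR R := if 0 < F x < 1 then x else x0.
have SX x : S (X x) by rewrite /X; case: ifPn.
have XS x : S x -> X x = x by rewrite /S/= /X => ->.
have mX : measurable_fun [set: measurableTypeR R] X.
  apply: measurable_fun_ifT => //.
  by apply: measurable_and; apply: measurable_fun_ltr.
have mFX : measurable_fun [set: measurableTypeR R] (F \o X) by exact: measurableT_comp.
have mFXle y : measurable [set x | F (X x) <= N y].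
  rewrite (_ : [set x | _] = (F \o X) @^-1` `]-oo, N y]%classic); last first.
    by apply/seteqP; split => x /=; rewrite in_itv.
  by rewrite -[X in measurable X]setTI; exact: mFX.
pose Y : measurableTypeR R -> measurableTypeR R := T \o X.
have mY : measurable_fun [set: measurableTypeR R] Y.
  apply: (measurability (@RGenOInfty.G R)) => [|/= _ [_] [y] -> <-].
    exact: RGenOInfty.measurableE.
  rewrite setTI (_ : _ @^-1` _ = ~` [set x | F (X x) <= N y]); first exact: measurableC.
  apply/seteqP; split => x /=; rewrite in_itv/= andbT ltNge T_le//.
    by move/negP.
  by move=> ?; apply/negP.
exists X, Y; split => //.
- move=> A mA; apply: ae_S => //; first by rewrite -[X in measurable X]setTI; exact: mX.
  by apply/seteqP; split => x /= [+ Sx]; rewrite XS.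
- move=> A mA.
  pose Y' := mfun_Sub (mem_set mY).
  pose Q : probability (measurableTypeR R) R := distribution m Y'.
  suff QN : forall B : set (measurableTypeR R), measurable B -> Q B = nu B by exact: QN.
  apply: eq_probability_dfun => y.
  rewrite (dfunE nu) -(m_sublevel (u := N y)); last by rewrite dfun_ge0 dfun_le1.
  have -> : Q `]-oo, y]%classic = m [set x | F (X x) <= N y].
    congr (m _); apply/seteqP; split => x /=; rewrite in_itv/=.
      by rewrite -T_le.
    by rewrite -T_le.
  apply: ae_S; [exact: mFXle|exact: measurable_sublevel|].
  by apply/seteqP; split => x /= [+ Sx]; rewrite XS.
- rewrite /Y; split => [s t|s t st] /=; first by move=> ->.
  have h : F (X t) <= N (T (X t)) by rewrite -T_le.
  by rewrite T_le//; exact: le_trans (dfun_nd m st) h.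
Qed.

End MonotoneTransport.

Section Law.
Variables (R : realType) (m nu : probability (measurableTypeR R) R).
Variable Y : measurableTypeR R -> measurableTypeR R.
Hypothesis mY : measurable_fun [set: measurableTypeR R] Y.
Hypothesis lawY : forall A : set (measurableTypeR R), measurable A ->
  pushforward m Y A = nu A.

Lemma law_integrable (f : R -> R) : nu.-integrable [set: R] (EFin \o f) ->
  m.-integrable [set: R] (EFin \o (f \o Y)).
Proof.
move=> fi; have mf := Rintegrable_measurable fi; apply/integrableP; split.
  by apply/measurable_EFinP; exact: (measurableT_comp mf mY).
have /integrableP[_] := fi; apply: le_lt_trans.
have mf' : measurable_fun [set: measurableTypeR R] (fun y : R => `|(f y)%:E|%E).
  by apply: measurableT_comp => //; exact/measurable_EFinP.
have := @ge0_integral_pushforward _ _ _ _ R Y mY m setT _ measurableT mf'.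
rewrite preimage_setT => <-; last by [].
by rewrite le_eqVlt (@eq_measure_integral _ _ _ _ nu) ?eqxx// => A mA _; exact: lawY.
Qed.

Lemma law_Rintegral (f : R -> R) : nu.-integrable [set: R] (EFin \o f) ->
  \int[nu]_y f y = \int[m]_x f (Y x).
Proof.
move=> fi; have mf := Rintegrable_measurable fi.
have fYi := law_integrable fi; congr fine.
have := @integral_pushforward _ _ _ _ R Y mY m setT (EFin \o f)
  (measurable_int _ fi) fYi measurableT.
rewrite preimage_setT => <-.
by apply: eq_measure_integral => A mA _; apply/esym; exact: lawY.
Qed.

Let Y2 (z : measurableTypeR R * measurableTypeR R) : measurableTypeR R * measurableTypeR R :=
  (Y z.1, Y z.2).

Let mY2 : measurable_fun setT Y2.
Proof.
by apply/measurable_fun_pairP; split; exact: (measurableT_comp mY).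
Qed.

Let lawY2 (A : set (measurableTypeR R * measurableTypeR R)) : measurable A ->
  (nu \x nu)%E A = pushforward (m \x m)%E Y2 A.
Proof.
move=> mA; pose phi := mfun_Sub (mem_set mY2).
pose mu := pushforward (m \x m)%E phi.
apply: (product_measure_unique (m' := mu)) => // B C mB mC.
transitivity ((m \x m)%E ((Y @^-1` B) `*` (Y @^-1` C))); first by [].
rewrite product_measure1E; first by congr (_ * _)%E; exact: lawY.
- by rewrite -[X in measurable X]setTI; exact: mY.
- by rewrite -[X in measurable X]setTI; exact: mY.
Qed.

Lemma law2_Rintegral (f : R * R -> R) :
  measurable_fun [set: measurableTypeR R * measurableTypeR R] f ->
  (m \x m)%E.-integrable setT (EFin \o (f \o Y2)) ->
  \int[(nu \x nu)%E]_z f z = \int[(m \x m)%E]_z f (Y z.1, Y z.2).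
Proof.
move=> mf fi; congr fine.
have mEf : measurable_fun setT (EFin \o f) by exact/measurable_EFinP.
have := @integral_pushforward _ _ _ _ R Y2 mY2 (m \x m)%E setT (EFin \o f)
  mEf fi measurableT.
rewrite preimage_setT => <-.
by apply: eq_measure_integral => A mA _; exact: lawY2.
Qed.

End Law.

(** * The energy inequality *)

Section Comparison.
Variables (R : realType) (w : R -> R) (k p lambda : R).
Hypotheses (k_ge0 : 0 <= k) (p_ge0 : 0 <= p) (lambda_gt0 : 0 < lambda).
Hypothesis w_tangent : forall a b : R, 0 < a -> 0 < b ->
  w a - k * a `^ (- p) * (b - a) <= w b.
Variables m nu : probability (measurableTypeR R) R.
Hypothesis m_atomless : forall x : R, m [set x] = 0%E.
Hypothesis m_moment2 : m.-integrable [set: R] (EFin \o (fun x => x ^+ 2)).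
Hypothesis nu_moment2 : nu.-integrable [set: R] (EFin \o (fun x => x ^+ 2)).
Local Notation trunc_interaction e mu :=
  (\int[(mu \x mu)%E]_z trunc_kernel w k p e (z.1 - z.2)).

Lemma trunc_comparison e : 0 < e ->
  2^-1 * trunc_interaction e m + lambda / 2 * \int[m]_x x ^+ 2
  - (2 * lambda)^-1 * \int[m]_x (trunc_field k p m e x + lambda * x) ^+ 2
  <= 2^-1 * trunc_interaction e nu + lambda / 2 * \int[nu]_x x ^+ 2.
Proof.
move=> e0.
have [X [Y [mX mY lawX lawY [XYeq XYle]]]] := monotone_transport nu m_atomless.
have X2i := law_integrable mX lawX m_moment2.
have Y2i := law_integrable mY lawY nu_moment2.
have Xi := law_integrable mX lawX (integrable_id m_moment2).
have Yi := law_integrable mY lawY (integrable_id nu_moment2).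
pose G := trunc_field k p m e.
have mG : measurable_fun [set: R] G by exact: measurable_trunc_field.
have GL x : `|G x| <= trunc_lip k p e by exact: trunc_field_bound.
have mGX : measurable_fun [set: measurableTypeR R] (fun t => G (X t)).
  exact: (measurableT_comp mG mX).
pose D t : R := Y t - X t.
have Di : m.-integrable setT (EFin \o D) by exact: RintegrableB.
have DGi : m.-integrable setT (EFin \o (fun t => G (X t) * D t)).
  exact: (RintegrableM mGX (fun t => GL (X t)) Di).
have kYi := integrable_trunc_interaction k_ge0 p_ge0 w_tangent e0 Yi.
have kXi := integrable_trunc_interaction k_ge0 p_ge0 w_tangent e0 Xi.
have mk : measurable_fun [set: measurableTypeR R * measurableTypeR R]
    (fun z : R * R => trunc_kernel w k p e (z.1 - z.2)).
  apply: (measurableT_comp (measurable_trunc_kernel k_ge0 p_ge0 w_tangent e0)).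
  exact: measurable_funB.
have mg : measurable_fun [set: measurableTypeR R * measurableTypeR R]
    (fun z => trunc_force k p e (X z.1 - X z.2)).
  apply: (measurableT_comp (measurable_trunc_force k_ge0 p_ge0 e0)).
  by apply: measurable_funB; exact: (measurableT_comp mX).
have gL (z : measurableTypeR R * measurableTypeR R) :
  `|trunc_force k p e (X z.1 - X z.2)| <= trunc_lip k p e by exact: trunc_force_bound.
have g1i : (m \x m)%E.-integrable setT
    (EFin \o (fun z : measurableTypeR R * measurableTypeR R =>
    trunc_force k p e (X z.1 - X z.2) * D z.1)).
  exact: (RintegrableM mg gL (integrable_prod_fst m Di)).
have g2i : (m \x m)%E.-integrable setT
    (EFin \o (fun z : measurableTypeR R * measurableTypeR R =>
    trunc_force k p e (X z.1 - X z.2) * D z.2)).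
  exact: (RintegrableM mg gL (integrable_prod_snd m Di)).
have GE t : \int[m]_t' trunc_force k p e (X t - X t') = G (X t).
  by rewrite /G /trunc_field
    (law_Rintegral mX lawX (integrable_trunc_force k_ge0 p_ge0 m (X t) e0)).
have fXi t : m.-integrable setT (EFin \o (fun t' => trunc_force k p e (X t - X t'))).
  exact: (law_integrable mX lawX (integrable_trunc_force k_ge0 p_ge0 m (X t) e0)).
have g1E : \int[(m \x m)%E]_z (trunc_force k p e (X z.1 - X z.2) * D z.1)
    = \int[m]_t (G (X t) * D t).
  congr fine; rewrite -(integral12_prod_meas1 g1i); apply: eq_integral => t _.
  rewrite /fubini_F/=; under eq_integral do rewrite mulrC EFinM.
  rewrite integralZl//; last exact: fXi.
  have := integrable_fin_num measurableT (fXi t).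
  by move/fineK => <-; rewrite -EFinM mulrC -GE.
have g2E : \int[(m \x m)%E]_z (trunc_force k p e (X z.1 - X z.2) * D z.2)
    = - \int[m]_t (G (X t) * D t).
  have -> : - (\int[m]_t (G (X t) * D t)) = \int[m]_t (- 1 * (G (X t) * D t)).
    by rewrite RintegralZl// mulN1r.
  congr fine; rewrite -(integral21_prod_meas1 g2i); apply: eq_integral => u _.
  rewrite /fubini_G/=.
  have -> : (fun x : measurableTypeR R => (trunc_force k p e (X x - X u) * D u)%:E) =
      (fun x => (- D u)%:E * (trunc_force k p e (X u - X x))%:E)%E.
    apply/funext => x; rewrite -EFinM; congr EFin.
    by rewrite -[X x - X u]opprB trunc_forceN; ring.
  rewrite integralZl//; last exact: fXi.
  have := integrable_fin_num measurableT (fXi u).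
  by move/fineK => <-; rewrite -EFinM -[fine _]/(Rintegral _ _ _) GE; congr EFin; ring.
have Jge0 : 0 <= \int[(m \x m)%E]_z
    (trunc_kernel w k p e (Y z.1 - Y z.2) - trunc_kernel w k p e (X z.1 - X z.2)
     - (trunc_force k p e (X z.1 - X z.2) * D z.1
        - trunc_force k p e (X z.1 - X z.2) * D z.2)).
  apply: Rintegral_ge0 => -[s1 s2] _ /=.
  have := @trunc_kernel_tangent R w k p k_ge0 p_ge0 w_tangent e e0 (X s1 - X s2) (Y s1 - Y s2).
  move=> H; have {}H : trunc_kernel w k p e (X s1 - X s2) +
      trunc_force k p e (X s1 - X s2) * (Y s1 - Y s2 - (X s1 - X s2)) <=
      trunc_kernel w k p e (Y s1 - Y s2).
    apply: H; first by move/subr0_eq/XYeq => ->; rewrite subrr.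
    have [st|ts] := leP (X s1) (X s2).
      by rewrite mulr_le0// subr_le0//; exact: XYle.
    by rewrite mulr_ge0// subr_ge0; [exact: ltW|apply: XYle; exact: ltW].
  by rewrite /D; lra.
rewrite (RintegralB measurableT (RintegrableB kYi kXi) (RintegrableB g1i g2i)) in Jge0.
rewrite (RintegralB measurableT kYi kXi) (RintegralB measurableT g1i g2i) in Jge0.
rewrite g1E g2E in Jge0.
have kE (Z : measurableTypeR R -> measurableTypeR R) (mu : probability (measurableTypeR R) R)
    (mZ : measurable_fun setT Z)
    (lawZ : forall A : set (measurableTypeR R), measurable A -> pushforward m Z A = mu A) :
    m.-integrable setT (EFin \o Z) ->
    trunc_interaction e mu = \int[(m \x m)%E]_z trunc_kernel w k p e (Z z.1 - Z z.2).
  move=> Zi; rewrite (law2_Rintegral mZ lawZ mk)//.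
  exact: integrable_trunc_interaction.
rewrite -(kE Y nu mY lawY Yi) -(kE X m mX lawX Xi) in Jge0.
pose Q (x : R) := (G x + lambda * x) ^+ 2.
have Qi : m.-integrable setT (EFin \o Q).
  exact: (integrable_affine_sqr m_moment2 lambda mG GL).
have QXi := law_integrable mX lawX Qi.
have Hfin : 0 <= \int[m]_t ((lambda / 2 * Y t ^+ 2 - lambda / 2 * X t ^+ 2)
    + (G (X t) * D t + (2 * lambda)^-1 * Q (X t))).
  apply: Rintegral_ge0 => t _; rewrite /Q /D.
  have -> : lambda / 2 * Y t ^+ 2 - lambda / 2 * X t ^+ 2 +
   (G (X t) * (Y t - X t) + (2 * lambda)^-1 * (G (X t) + lambda * X t) ^+ 2) =
   (2 * lambda)^-1 * (lambda * (Y t - X t) + (G (X t) + lambda * X t)) ^+ 2.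
    by field; rewrite gt_eqF.
  by rewrite mulr_ge0 ?sqr_ge0// invr_ge0 mulr_ge0// ltW.
have cY2 := RintegrableZ (lambda / 2) Y2i; have cX2 := RintegrableZ (lambda / 2) X2i.
have cQ := RintegrableZ (2 * lambda)^-1 QXi.
rewrite (RintegralD measurableT (RintegrableB cY2 cX2) (RintegrableD DGi cQ)) in Hfin.
rewrite (RintegralD measurableT DGi cQ) (RintegralB measurableT cY2 cX2) in Hfin.
rewrite (RintegralZl _ measurableT Y2i) (RintegralZl _ measurableT X2i)
  (RintegralZl _ measurableT QXi) in Hfin.
rewrite (law_Rintegral mX lawX m_moment2) (law_Rintegral mY lawY nu_moment2).
rewrite (law_Rintegral mX lawX Qi).
by lra.
Qed.

End Comparison.

Section EssentialBound.
Variable R : realType.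

Lemma Lfun_infty_bound (rho : R -> R) :
  rho \in Lfun (@lebesgue_measure R) +oo%E ->
  exists M : R, {ae @lebesgue_measure R, forall x, rho x <= M}.
Proof.
move=> /sub_Lfun_finLfun; rewrite inE /finite_norm unlock /Lnorm.
rewrite /=; case: ifPn => [_|]; last first.
  rewrite -leNgt => h _; exists 0.
  have T0 : (@lebesgue_measure R) setT = 0%E by apply/eqP; rewrite eq_le h measure_ge0.
  by exists setT; split.
set S := ess_sup_inf.ess_sup _ _; move=> Slt.
have [M SM] : exists M : R, (S <= M%:E)%E.
  by move: Slt; case: S => [r _|//|_]; [exists r|exists 0; rewrite leNye].
exists M; have := ess_sup_inf.ess_sup_ge (@lebesgue_measure R) (abse \o (EFin \o rho)).
apply: filterS => x /= h.
rewrite -lee_fin (le_trans _ SM)// (le_trans _ h)// lee_fin; exact: ler_norm.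
Qed.

End EssentialBound.

Section EnergyDissipation.
Variables (R : realType) (w : R -> R) (k p K a lambda : R) (W : R -> \bar R).
Implicit Types e x z : R.
Hypotheses (k_ge0 : 0 <= k) (p_ge0 : 0 <= p) (lambda_gt0 : 0 < lambda).
Hypothesis w_tangent : forall a b : R, 0 < a -> 0 < b ->
  w a - k * a `^ (- p) * (b - a) <= w b.
Hypothesis mW : measurable_fun [set: R] W.
Hypothesis WE : forall z, z != 0 -> W z = (w `|z|)%:E.
Hypothesis W0 : forall e, 0 < e -> ((trunc_kernel w k p e 0)%:E <= W 0)%E.
Hypotheses (K_ge0 : 0 <= K) (a_gt : -1 < a).
Hypothesis w_singular : forall x e, 0 < x -> x < e -> e <= 1 ->
  w x - w e <= K * x `^ a.
Local Notation leb := (@lebesgue_measure R).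
Variables (m nu : probability (measurableTypeR R) R) (rho : R -> R) (M C alpha : R).
Hypothesis rho_ge0 : forall x, 0 <= rho x.
Hypothesis rho_int : leb.-integrable [set: R] (EFin \o rho).
Hypothesis m_density : forall A : set (measurableTypeR R), measurable A ->
  (m A = \int[leb]_(x in A) (rho x)%:E)%E.
Hypothesis rho_le : {ae leb, forall x, rho x <= M}.
Hypothesis rho_hoelder : forall x y, `|rho x - rho y| <= C * `|x - y| `^ alpha.
Hypothesis alpha_gt : -1 < alpha - p.
Hypothesis m_moment2 : m.-integrable [set: R] (EFin \o (fun x => x ^+ 2)).
Hypothesis nu_moment2 : nu.-integrable [set: R] (EFin \o (fun x => x ^+ 2)).

Let mrho : measurable_fun [set: R] rho.
Proof. by apply/measurable_EFinP; exact: measurable_int rho_int. Qed.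

Let m_atomless x : m [set x] = 0%E.
Proof.
rewrite m_density; last exact: measurable_set1.
by rewrite integral_set1.
Qed.

Let f x : R := fine (\int[leb]_y (W (x - y)%R * (rho y)%:E))%E.
Let u e : R := potential_modulus K a M e.
Let v e : R := field_modulus k p C alpha e.
Let G e x : R := trunc_field k p m e x.

Let C_ge0 : 0 <= C.
Proof.
by have := rho_hoelder 0 1; rewrite sub0r normrN1 powR1 mulr1; exact: le_trans.
Qed.

Let u_vanishing : vanishing u.
Proof.
have -> : u = fun e => (M * (K * (2 / (1 + a)))) * e `^ (1 + a).
  by apply/funext => e; rewrite /u /potential_modulus; ring.
by apply: vanishing_powR; move: a_gt => ?; lra.
Qed.

Let v_vanishing : vanishing v.
Proof.
have -> : v = fun e => (k * C * (2 / (1 + (alpha - p)))) * e `^ (1 + (alpha - p)).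
  by apply/funext => e; rewrite /v /field_modulus; ring.
by apply: vanishing_powR; move: alpha_gt => ?; lra.
Qed.

Let v_ge0 e : 0 <= v e.
Proof.
have q0 : 0 <= 1 + (alpha - p) by move: alpha_gt => ?; lra.
by rewrite /v /field_modulus !mulr_ge0 ?powR_ge0// invr_ge0.
Qed.

Let v_le1 e : 0 < e -> e <= 1 -> v e <= v 1.
Proof.
move=> e0 e1; have q0 : 0 <= 1 + (alpha - p) by move: alpha_gt => ?; lra.
rewrite /v /field_modulus ler_wpM2l ?mulr_ge0// ler_wpM2l// ler_wpM2r ?invr_ge0//.
by apply: ge0_ler_powR; rewrite ?nnegrE// ltW.
Qed.

Let FG e x h : 0 < e ->
  `|trunc_potential w k p m e (x + h) - trunc_potential w k p m e x - h * G e x|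
  <= (trunc_slope_lip k p e + 4 * trunc_lip k p e * M) * h ^+ 2.
Proof.
move=> e0.
exact: (trunc_potential_taylor k_ge0 p_ge0 w_tangent (integrable_id m_moment2)
  rho_ge0 mrho m_density rho_le).
Qed.

Let G_cauchy d e x : 0 < d -> d <= e -> `|G d x - G e x| <= v e.
Proof.
move=> d0 de.
exact: (trunc_field_cauchy k_ge0 p_ge0 rho_ge0 rho_int m_density rho_hoelder alpha_gt).
Qed.

Let F_cvg e x : 0 < e -> e <= 1 -> `|f x - trunc_potential w k p m e x| <= u e.
Proof.
move=> e0 e1.
exact: (potential_approx k_ge0 p_ge0 w_tangent mW WE W0 K_ge0 a_gt w_singular
  (integrable_id m_moment2) rho_ge0 mrho m_density rho_le).
Qed.

Let derive_field e x : 0 < e -> e <= 1 -> `|f^`()%classic x - G e x| <= v e.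
Proof. exact: (uniform_limit_derive1 FG G_cauchy F_cvg u_vanishing v_vanishing). Qed.

Let measurable_derive : measurable_fun [set: R] f^`()%classic.
Proof.
apply: (@measurable_fun_cvg _ (measurableTypeR R) R setT (fun n x => G n.+1%:R^-1 x)) => //.
  by move=> n; apply: measurable_trunc_field => //; rewrite invr_gt0.
move=> x _; apply/cvgrPdist_le => eta eta0.
have [d /andP[d0 _] vd] := v_vanishing eta0.
near=> n; have n0 : (0 : R) < n.+1%:R^-1 by rewrite invr_gt0.
have n1 : (n.+1%:R^-1 : R) <= 1 by rewrite invf_le1// ler1n.
apply: (le_trans (derive_field x n0 n1)); apply: vd => //; apply: ltW.
by near: n; exact: (near_infty_natSinv_lt (PosNum d0)).
Unshelve. all: by end_near. Qed.

Let Q x : R := (f^`()%classic x + lambda * x) ^+ 2.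

Let mQ : measurable_fun [set: R] Q.
Proof.
by apply: measurable_funX; apply: measurable_funD => //; exact: measurable_funM.
Qed.

Let Q_integrable : m.-integrable [set: R] (EFin \o Q).
Proof.
pose L := trunc_lip k p 1 + v 1.
have fL x : `|f^`()%classic x| <= L.
  have := ler_normD (f^`()%classic x - G 1 x) (G 1 x); rewrite subrK.
  have := derive_field x ltr01 (lexx 1).
  have := @trunc_field_bound R k p k_ge0 p_ge0 m 1 x ltr01.
  rewrite -/(G 1 x) /L => *; lra.
exact: integrable_affine_sqr measurable_derive fL.
Qed.

Let dissipationE : (\int[leb]_x (`|f^`()%classic x + lambda * x| ^+ 2 * rho x)%:E
  = (\int[m]_x Q x)%:E)%E.
Proof.
have := integral_density rho_ge0 mrho m_density (f := EFin \o Q).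
rewrite /Rintegral => H; rewrite fineK; last exact: integrable_fin_num.
rewrite H; last exact/measurable_EFinP.
by apply: eq_integral => x _; rewrite /= real_normK ?num_real.
Qed.

Let trunc_dissipation_le e : 0 < e -> e <= 1 ->
  \int[m]_x (G e x + lambda * x) ^+ 2 <=
  (1 + v e) * \int[m]_x Q x + (v e + v e ^+ 2).
Proof.
move=> e0 e1.
have vQ : m.-integrable [set: R] (EFin \o (fun x => (1 + v e) * Q x)) by exact: RintegrableZ.
have Ie : m.-integrable [set: R] (EFin \o (fun x => (1 + v e) * Q x + (v e + v e ^+ 2))).
  by apply: RintegrableD => //; exact: Rintegrable_cst.
have GQ x : (G e x + lambda * x) ^+ 2 <= (1 + v e) * Q x + (v e + v e ^+ 2).
  rewrite /Q; have := derive_field x e0 e1; have := v_ge0 e.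
  move: (f^`()%classic x) (G e x) (v e) => b g ve ve0; rewrite ler_norml => /andP[h1 h2].
  have h3 : (b - g) ^+ 2 <= ve ^+ 2.
    by rewrite -(real_normK (num_real (b - g))) lerXn2r ?nnegrE// ler_norml h1.
  have h4 : 0 <= (ve + (b - g)) * (1 + (b + lambda * x)) ^+ 2.
    by rewrite mulr_ge0 ?sqr_ge0//; lra.
  have h5 : 0 <= (ve - (b - g)) * (1 - (b + lambda * x)) ^+ 2.
    by rewrite mulr_ge0 ?sqr_ge0//; lra.
  by lra.
have Gi : m.-integrable [set: R] (EFin \o (fun x => (G e x + lambda * x) ^+ 2)).
  apply: (@integrable_affine_sqr _ _ m_moment2 (trunc_lip k p e)).
    exact: measurable_trunc_field.
  by move=> x; exact: trunc_field_bound.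
apply: (@le_trans _ _ (\int[m]_x ((1 + v e) * Q x + (v e + v e ^+ 2)))).
  by apply: le_Rintegral => // x _; exact: GQ.
rewrite (RintegralD measurableT vQ (Rintegrable_cst m _)).
by rewrite (RintegralZl _ measurableT Q_integrable) Rintegral_probability_cst.
Qed.

Let trunc_interaction e (mu : probability (measurableTypeR R) R) : R :=
  \int[(mu \x mu)%E]_z trunc_kernel w k p e (z.1 - z.2).

Let interaction_ge e : 0 < e ->
  ((trunc_interaction e nu)%:E <= \int[nu \x nu]_z W (z.1 - z.2)%R)%E.
Proof.
move=> e0.
have ik := integrable_trunc_interaction k_ge0 p_ge0 w_tangent e0
  (integrable_id nu_moment2).
rewrite /trunc_interaction /Rintegral fineK; last exact: (integrable_fin_num measurableT ik).
have mk := measurable_int _ ik.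
have mWz : measurable_fun [set: measurableTypeR R * measurableTypeR R]
    (fun z : R * R => W (z.1 - z.2)).
  by apply: (measurableT_comp mW); exact: measurable_funB.
rewrite integralE [leRHS]integralE; apply: leeB.
- apply: ge0_le_integral => //; [exact: measurable_funepos|exact: measurable_funepos|].
  move=> z _; rewrite !funeposE; apply: le_max2 => //.
  exact: trunc_kernel_le.
- apply: ge0_le_integral => //; [exact: measurable_funeneg|exact: measurable_funeneg|].
  move=> z _; rewrite !funenegE; apply: le_max2 => //.
  by rewrite leeN2; exact: trunc_kernel_le.
Qed.

Definition total_energy (mu : probability (measurableTypeR R) R) : \bar R :=
  ((2^-1)%:E * \int[mu \x mu]_z W (z.1 - z.2)%R
   + (lambda / 2)%:E * \int[mu]_x (x ^+ 2)%:E)%E.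

Let total_energy_ge e : 0 < e ->
  ((2^-1 * trunc_interaction e nu + lambda / 2 * \int[nu]_x x ^+ 2)%:E <= total_energy nu)%E.
Proof.
move=> e0; rewrite EFinD !EFinM; apply: leeD.
  by apply: lee_wpmul2l; rewrite ?lee_fin ?invr_ge0// interaction_ge.
by rewrite /Rintegral fineK//; exact: (integrable_fin_num measurableT nu_moment2).
Qed.

Let total_energy_le e : 0 < e -> e <= 1 ->
  (total_energy m <=
   (2^-1 * (trunc_interaction e m + u e) + lambda / 2 * \int[m]_x x ^+ 2)%:E)%E.
Proof.
move=> e0 e1; rewrite EFinD !EFinM; apply: leeD.
  apply: lee_wpmul2l; rewrite ?lee_fin ?invr_ge0// EFinD.
  have ik := integrable_trunc_interaction k_ge0 p_ge0 w_tangent e0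
    (integrable_id m_moment2).
  rewrite /trunc_interaction /Rintegral fineK; last exact: (integrable_fin_num measurableT ik).
  exact: (interaction_le k_ge0 p_ge0 w_tangent mW WE W0 K_ge0 a_gt w_singular
    (integrable_id m_moment2) rho_ge0 mrho m_density rho_le).
by rewrite /Rintegral fineK//; exact: (integrable_fin_num measurableT m_moment2).
Qed.

Lemma energy_dissipation_le :
  (total_energy m - total_energy nu <= ((2 * lambda)^-1)%:E *
    \int[leb]_x (`|f^`()%classic x + lambda * x| ^+ 2 * rho x)%:E)%E.
Proof.
rewrite dissipationE -EFinM.
have lo := total_energy_ge ltr01; have up := total_energy_le ltr01 (lexx 1).
case Enu: (total_energy nu) lo => [en| |]//= lo; last by rewrite addeNy leNye.
case Em: (total_energy m) up => [em| |]//= _; last by rewrite leNye.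
rewrite -EFinB lee_fin -subr_le0.
set I := \int[m]_x Q x.
pose c1 := (2 * lambda)^-1 * (I + 1 + v 1).
have I0 : 0 <= I by apply: Rintegral_ge0 => x _; exact: sqr_ge0.
have l0 : 0 <= (2 * lambda)^-1 by rewrite invr_ge0 mulr_ge0// ltW.
have c10 : 0 <= c1 by rewrite mulr_ge0// !addr_ge0.
have c20 : 0 <= 2^-1 :> R by rewrite invr_ge0.
apply: (vanishing_le0 (vanishingD (vanishingZ c20 u_vanishing) (vanishingZ c10 v_vanishing))).
move=> e e0 e1.
have := total_energy_ge e0; rewrite Enu lee_fin => h1.
have := total_energy_le e0 e1; rewrite Em lee_fin => h2.
have h3 := trunc_comparison k_ge0 p_ge0 lambda_gt0 w_tangent m_atomless m_moment2 nu_moment2 e0.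
have h4 := ler_wpM2l l0 (trunc_dissipation_le e0 e1).
have h5 : v e ^+ 2 <= v 1 * v e by rewrite expr2 ler_wpM2r// v_le1.
have h6 := ler_wpM2l l0 h5.
rewrite -/(trunc_interaction e m) -/(trunc_interaction e nu) in h3.
rewrite -/I in h4; rewrite /c1; lra.
Qed.

End EnergyDissipation.

(** * The Riesz kernel *)

Section RieszKernel.
Variables (R : realType) (s : R).
Hypotheses (s_gt0 : 0 < s) (s_le1 : s <= 1).
Implicit Types a b e x z : R.
Local Notation c := (riesz_const s).

Let gamma_integral_ge0 x : 0 <= gamma_integral x.
Proof.
by apply: Rintegral_ge0 => t _; rewrite mulr_ge0 ?powR_ge0 ?expR_ge0.
Qed.

Let gamma1s_ge0 : 0 <= gamma (1 + s).
Proof. by rewrite /gamma addr_gt0. Qed.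

Lemma riesz_const_ge0 : s < 2^-1 -> 0 <= c.
Proof.
move=> s2; have g0 : 0 <= gamma (2^-1 - s) by rewrite /gamma subr_gt0 s2.
rewrite /riesz_const divr_ge0//.
  by rewrite mulr_ge0// mulr_ge0 ?powR_ge0// ltW.
by rewrite mulr_ge0// sqrtr_ge0.
Qed.

Lemma riesz_const_le0 : 2^-1 < s -> c <= 0.
Proof.
move=> s2; have g0 : gamma (2^-1 - s) <= 0.
  rewrite /gamma subr_gt0 ltNge (ltW s2)/=.
  by rewrite mulr_ge0_le0// invr_le0 subr_le0 ltW.
rewrite /riesz_const mulr_le0_ge0//.
  by rewrite mulr_ge0_le0// mulr_ge0 ?powR_ge0// ltW.
by rewrite invr_ge0 mulr_ge0// sqrtr_ge0.
Qed.

Definition riesz_profile x : R :=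
  if s == 2^-1 then - (pi^-1 * ln x) else c * x `^ (2 * s - 1).

(* The derivative of the profile is - slope_const * x `^ (- (2 - 2 * s)) for
   every s, the logarithmic case included. *)
Definition slope_const : R := if s == 2^-1 then pi^-1 else - (c * (2 * s - 1)).

Lemma riesz_exponent_ge0 : 0 <= 2 - 2 * s.
Proof. by move: s_le1; lra. Qed.

Lemma slope_const_ge0 : 0 <= slope_const.
Proof.
rewrite /slope_const; case: (ltgtP s 2^-1) => s2.
- by rewrite oppr_ge0 mulr_ge0_le0 ?riesz_const_ge0//; lra.
- by rewrite oppr_ge0 mulr_le0_ge0 ?riesz_const_le0//; lra.
- by rewrite invr_ge0 pi_ge0.
Qed.

Lemma riesz_profile_tangent a b : 0 < a -> 0 < b ->
  riesz_profile a - slope_const * a `^ (- (2 - 2 * s)) * (b - a) <= riesz_profile b.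
Proof.
move=> a0 b0; rewrite /riesz_profile /slope_const.
have -> : - (2 - 2 * s) = 2 * s - 1 - 1 by ring.
case: (ltgtP s 2^-1) => s2.
- have c0 := riesz_const_ge0 s2; have q0 : 2 * s - 1 <= 0 by lra.
  have := ler_wpM2l c0 (powR_ge_tangent q0 a0 b0) => ?; lra.
- have c0 := riesz_const_le0 s2; have s1 := s_le1.
  have q0 : 0 <= 2 * s - 1 <= 1 by apply/andP; split; lra.
  have := ler_wnM2l c0 (powR_le_tangent q0 a0 b0) => ?; lra.
- have -> : 2 * s - 1 - 1 = - 1 by rewrite s2; field.
  rewrite (powR_inv1 (ltW a0)).
  have := ln_le_subr1 (divr_gt0 b0 a0); rewrite ln_div ?posrE// => H.
  have pi0 : 0 <= pi^-1 :> R by rewrite invr_ge0 pi_ge0.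
  have := ler_wpM2l pi0 H.
  have -> : b / a - 1 = a^-1 * (b - a) by field; rewrite gt_eqF.
  by move=> ?; lra.
Qed.

Lemma riesz_kernelE z : z != 0 -> riesz_kernel s z = (riesz_profile `|z|)%:E.
Proof. by move=> z0; rewrite /riesz_kernel (negbTE z0)/= /riesz_profile; case: ifP. Qed.

Lemma riesz_kernel0_ge e : 0 < e ->
  ((trunc_kernel riesz_profile slope_const (2 - 2 * s) e 0)%:E <= riesz_kernel s 0)%E.
Proof.
move=> e0; rewrite /riesz_kernel eqxx/=; have [s2|s2] := leP s 2^-1; first by rewrite leey.
rewrite gt_eqF// normr0 powR0; last by rewrite gt_eqF//; lra.
rewrite mulr0 lee_fin /trunc_kernel normr0 trunc_profileE'; last exact: ltW.
rewrite subr0 /riesz_profile /trunc_lip /slope_const gt_eqF//.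
have -> : - (2 - 2 * s) = 2 * s - 1 - 1 by ring.
have q0 : 0 < 2 * s - 1 by lra.
have ee := mulr_powRB1 (ltW e0) q0.
have -> : - (c * (2 * s - 1)) * e `^ (2 * s - 1 - 1) * e
   = - (c * (2 * s - 1)) * e `^ (2 * s - 1) by rewrite -[in RHS]ee; ring.
have h : 0 <= - c * e `^ (2 * s - 1) * (2 - 2 * s).
  rewrite mulr_ge0 ?riesz_exponent_ge0// mulr_ge0 ?powR_ge0//.
  by rewrite oppr_ge0 riesz_const_le0.
lra.
Qed.

Lemma riesz_profile_singular : exists K a, [/\ 0 <= K, -1 < a &
  forall x e, 0 < x -> x < e -> e <= 1 ->
    riesz_profile x - riesz_profile e <= K * x `^ a].
Proof.
have s0 := s_gt0; have s1 := s_le1.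
rewrite /riesz_profile; case: (ltgtP s 2^-1) => s2.
- exists c, (2 * s - 1); split; [exact: riesz_const_ge0|lra|].
  by move=> x e _ _ _; rewrite gerBl mulr_ge0 ?powR_ge0// riesz_const_ge0.
- have c0 := riesz_const_le0 s2.
  exists (- c), 0; split; [by rewrite oppr_ge0|lra|].
  move=> x e x0 xe e1; rewrite powRr0 mulr1.
  have h1 : c * x `^ (2 * s - 1) <= 0 by rewrite mulr_le0_ge0 ?powR_ge0.
  have h2 : e `^ (2 * s - 1) <= 1.
    apply: (@le_trans _ _ (1 `^ (2 * s - 1))); last by rewrite powR1.
    by apply: ge0_ler_powR; rewrite ?nnegrE ?ler01 ?(ltW (lt_trans x0 xe))//; lra.
  have := ler_wnM2l c0 h2 => ?; lra.
- have pi0 : 0 <= pi^-1 :> R by rewrite invr_ge0 pi_ge0.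
  exists (pi^-1 * 2), (- 2^-1); split; [by rewrite mulr_ge0|lra|].
  move=> x e x0 xe e1.
  have h1 : ln e <= 0 by exact: ln_le0.
  have h2 : - 2^-1 * ln x <= x `^ (- 2^-1).
    rewrite -ln_powR; have y0 := powR_gt0 (- 2^-1) x0.
    by have := ln_le_subr1 y0 => ?; lra.
  have h3 : pi^-1 * ln e <= 0 by rewrite mulr_ge0_le0.
  have := ler_wpM2l pi0 h2 => ?; lra.
Qed.

Lemma measurable_riesz_kernel : measurable_fun [set: R] (riesz_kernel s).
Proof.
apply: measurable_fun_ifT.
- apply: measurable_and; last exact: measurable_cst.
  exact: measurable_fun_eqr.
- exact: measurable_cst.
- case: (s == 2^-1); apply/measurable_EFinP.
  + apply: measurableT_comp => //; apply: measurable_funM => //.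
    exact: measurableT_comp.
  + apply: measurable_funM => //.
    exact: (measurableT_comp (measurable_powR _)).
Qed.

End RieszKernel.

Theorem mainTheorem2 (R : realType) (s lambda alpha : R) (rho : R -> R)
    (s_gt0 : 0 < s) (s_le1 : s <= 1) (lambda_gt0 : 0 < lambda)
    (alpha_gt : Num.max (1 - 2 * s) 0 < alpha) (alpha_le1 : alpha <= 1)
    (rho_L1 : rho \in Lfun (@lebesgue_measure R) 1%E)
    (rho_Linfty : rho \in Lfun (@lebesgue_measure R) +oo%E)
    (rho_hoelder : hoelder_continuous alpha rho)
    (rho_ge0 : forall x, 0 <= rho x)
    (rho_mass : (\int[lebesgue_measure]_x (rho x)%:E = 1)%E)
    (rho_moment : (\int[lebesgue_measure]_x (x ^+ 2 * rho x)%:E < +oo)%E)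
    (rho_infty : probability (measurableTypeR R) R)
    (rho_infty_min : energy_minimizer s lambda rho_infty) :
  (energy s lambda (density_prob rho_L1 rho_ge0 rho_mass)
     - energy s lambda rho_infty
   <= ((2 * lambda)^-1)%:E * entropy_dissipation s lambda rho)%E.
Proof.
have [C rhoC] := rho_hoelder.
have [M rhoM] := Lfun_infty_bound rho_Linfty.
have [K [a [K0 a1 sing]]] := riesz_profile_singular s_gt0 s_le1.
have rho_int : (@lebesgue_measure R).-integrable [set: R] (EFin \o rho).
  exact: (proj1 (Lfun1_integrable (@lebesgue_measure R) rho)) rho_L1.
have mrho : measurable_fun [set: R] rho.
  by apply/measurable_EFinP; exact: measurable_int rho_int.
pose m : probability (measurableTypeR R) R := density_prob rho_L1 rho_ge0 rho_mass.
have m_density (A : set (measurableTypeR R)) : measurable A ->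
    (m A = \int[lebesgue_measure]_(x in A) (rho x)%:E)%E by [].
have sqr_integrable (mu : probability (measurableTypeR R) R) :
    (\int[mu]_x (x ^+ 2)%:E < +oo)%E ->
    mu.-integrable [set: R] (EFin \o (fun x : R => x ^+ 2)).
  move=> h; apply/integrableP; split; first by apply/measurable_EFinP; exact: measurable_funX.
  by under eq_integral do rewrite gee0_abs ?lee_fin ?sqr_ge0//.
have m2 : m.-integrable [set: R] (EFin \o (fun x : R => x ^+ 2)).
  apply: sqr_integrable; rewrite (integral_density rho_ge0 mrho m_density)//.
  by apply/measurable_EFinP; exact: measurable_funX.
have nu2 := sqr_integrable _ rho_infty_min.1.
have alpha_p : -1 < alpha - (2 - 2 * s).
  by move: alpha_gt; rewrite gt_max => /andP[? _]; lra.
exact: (energy_dissipation_le (slope_const_ge0 s_gt0)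
  (riesz_exponent_ge0 s_le1) lambda_gt0 (riesz_profile_tangent s_gt0 s_le1)
  (measurable_riesz_kernel s) (@riesz_kernelE R s) (riesz_kernel0_ge s_gt0 s_le1) K0 a1 sing
  rho_ge0 rho_int m_density rhoM rhoC alpha_p m2 nu2).
Qed.
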